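(* Let $X,Y$ be complex Banach spaces, let $B_X$ be the open unit ball of $X$, and let $W\subset Y'$ be a subspace. Let $E_1$ and $E_2$ be Banach spaces of holomorphic functions $B_X\to\mathbb{C}$, each of which contains the constant functions and has closed unit ball compact in the compact-open topology of $B_X$. Let $\psi$ be a holomorphic function $B_X\to\mathbb{C}$ and let $\varphi$ be a holomorphic self-map of $B_X$. Consider $W_{\psi,\varphi}:E_1\to E_2$, $W_{\psi,\varphi}(f)=\psi\cdot(f\circ\varphi)$, and $\widetilde W_{\psi,\varphi}:WE_1(Y)\to WE_2(Y)$, $\widetilde W_{\psi,\varphi}(g)=\psi\cdot(g\circ\varphi)$. (1) If $W$ is separating, then $W_{\psi,\varphi}$ is bounded if and only if $\widetilde W_{\psi,\varphi}$ is bounded. (2) If $W$ is almost norming and $W_{\psi,\varphi}$ is compact, then: (a) $\widetilde W_{\psi,\varphi}$ is compact if and only if the identity map $I_Y:Y\to Y$ is compact, i.e. $\dim Y<\infty$; (b) $\widetilde W_{\psi,\varphi}$ is weakly compact if and only if the identity map $I_Y:Y\to Y$ is weakly compact.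
   Context: $Y'$ is the topological dual of $Y$. A subspace $W\subset Y'$ is separating if it separates the points of $Y$; it is almost norming if $q_W(y)=\sup_{w\in W,\|w\|\le1}|w(y)|$ defines an equivalent norm on $Y$. For a Banach space $E$ of holomorphic functions on $B_X$, $$WE(Y)=\{f:B_X\to Y:\ f\text{ is locally bounded and } w\circ f\in E\ \ \forall w\in W\},$$ with norm $\|f\|_{WE(Y)}=\sup_{w\in W,\|w\|\le 1}\|w\circ f\|_E$; locally bounded means that every point of $B_X$ has a neighbourhood on which $f$ is bounded. Boundedness of an operator between two spaces includes that it maps the first space into the second.
   Formalization: Part (1) assumes Y ≠ 0 and part (2) assumes ψ is not identically 0, as each claim fails otherwise; WE(Y) consists only of those f whose norm sup ‖w∘f‖ is finite, which can fail when W is not closed. *)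

(* Defs.v *)
From HB Require Import structures.
From mathcomp Require Import all_boot all_order all_algebra.
From mathcomp Require Import complex.
From mathcomp Require Import all_classical all_reals all_analysis.

Set Implicit Arguments.
Unset Strict Implicit.
Unset Printing Implicit Defensive.

Import Order.TTheory GRing.Theory Num.Theory.
Import numFieldNormedType.Exports.

Local Open Scope classical_set_scope.
Local Open Scope ring_scope.
Local Open Scope complex_scope.

(* Norms of normed modules over R[i] take values in the nonnegative reals of
   R[i], so the supremum of a set of norms is taken on real parts and embedded
   back into R[i]. *)
Definition csup {R : realType} (S : set R[i]) : R[i] :=
  (sup [set complex.Re z | z in S])%:C.

Section csup_theory.
Context {R : realType}.
Implicit Types (S : set R[i]) (M z : R[i]).

Lemma csup_le S M : 0 <= M -> (forall z, S z -> z <= M) -> csup S <= M.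
Proof.
move=> M0 SM; have -> : M = (complex.Re M)%:C.
  by rewrite RRe_real // ger0_real.
rewrite /csup lecR.
have [->|/set0P[z Sz]] := eqVneq S set0; last first.
  apply: ge_sup; first by exists (complex.Re z), z.
  move=> _ [t /SM tM <-].
  by move: tM; rewrite lecE => /andP[].
by rewrite image_set0 sup0; move: M0; rewrite lecE => /andP[].
Qed.

Lemma csup_ub S M z : (forall t, S t -> t \is Num.real) ->
  (forall t, S t -> t <= M) -> S z -> z <= csup S.
Proof.
move=> Sr SM Sz; rewrite -[leLHS]RRe_real ?Sr // /csup lecR.
apply: ub_le_sup; last by exists z.
exists (complex.Re M) => _ [t /SM tM <-].
by move: tM; rewrite lecE => /andP[].
Qed.

Lemma csup_ge0 S : (forall t, S t -> 0 <= t) -> 0 <= csup S.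
Proof.
move=> S0; rewrite /csup (_ : 0 = 0%:C) // lecR.
have [/[dup] -[[r Sr] _] hs|hs] := pselect (has_sup [set complex.Re z | z in S]).
  apply: le_trans (sup_upper_bound hs Sr).
  by case: Sr => t /S0 + <-; rewrite lecE => /andP[].
by rewrite sup_out.
Qed.

Lemma homog_of_le (V : lmodType R[i]) (N : V -> R[i]) :
  (forall (l : R[i]) v, N (l *: v) <= `|l| * N v) ->
  (forall v, 0 <= N v) -> forall (l : R[i]) v, N (l *: v) = `|l| * N v.
Proof.
move=> Nle N0 l v; have [->|l0] := eqVneq l 0.
  apply/eqP; rewrite normr0 mul0r eq_le N0 andbT.
  by have := Nle 0 v; rewrite normr0 mul0r.
apply/eqP; rewrite eq_le Nle /=.
have := Nle l^-1 (l *: v); rewrite scalerA mulVf // scale1r normfV.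
by rewrite -ler_pdivrMl ?invr_gt0 ?normr_gt0 // invrK.
Qed.

End csup_theory.

(* The topological dual, normed by the supremum over the closed unit ball. *)
Section dual.
Context {R : realType} (Y : normedModType R[i]).
Local Notation C := R[i].

Definition dual_pred : {pred Y -> C^o} :=
  fun f => `[< linear f /\ continuous f >].

Lemma dual_pred_submod : submod_closed dual_pred.
Proof.
split.
  apply/asboolP; split; last exact: cst_continuous.
  by move=> a u v; rewrite scaler0 addr0.
move=> a f g /asboolP[lf cf] /asboolP[lg cg]; apply/asboolP; split.
  move=> b u v; rewrite !fctE lf lg !scalerDr !scalerA addrACA.
  by rewrite mulrC.
by move=> x; apply: cvgD; [apply: cvgZr; exact: cf|exact: cg].
Qed.

HB.instance Definition _ :=
  GRing.isSubmodClosed.Build C (Y -> C^o) dual_pred dual_pred_submod.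

Record dual := Dual { dual_fun :> Y -> C^o ; _ : dual_fun \in dual_pred }.

HB.instance Definition _ := [isSub for dual_fun].
HB.instance Definition _ := [Choice of dual by <:].
HB.instance Definition _ := [SubChoice_isSubLmodule of dual by <:].

Lemma dual_lin (w : dual) (a : C) u v : w (a *: u + v) = a *: w u + w v.
Proof. by have /asboolP[lw _] := valP w; exact: lw. Qed.

Lemma dual0 (w : dual) : w 0 = 0.
Proof.
have := dual_lin w (-1) 0 0; rewrite scaler0 addr0 => ->.
by rewrite scaleN1r addNr.
Qed.

Definition dual_norm (w : dual) : C :=
  csup [set `|w y| | y in [set y : Y | `|y| <= 1]].

Lemma dual_bounded (w : dual) :
  exists2 M : C, 0 <= M & forall y, `|w y| <= M * `|y|.
Proof.
case: w => f /= /[dup] /asboolP[lf cf] _.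
pose F : {linear Y -> C^o} :=
  HB.pack f (GRing.isLinear.Build C Y C^o *:%R f lf).
have /(_ cf) /linear_boundedP [M [Mr MF]] := (linear_bounded_continuous F).2.
exists (`|M| + 1); first by rewrite addr_ge0.
by move=> y; apply: MF; rewrite (le_lt_trans (real_ler_norm Mr)) // ltrDl.
Qed.

Lemma dual_norm_ub (w : dual) y : `|y| <= 1 -> `|w y| <= dual_norm w.
Proof.
move=> y1; have [M M0 Mw] := dual_bounded w.
apply: (@csup_ub _ _ M); last by exists y.
  by move=> _ [t _ <-]; exact: normr_real.
move=> _ [t /= t1 <-]; apply: le_trans (Mw t) _.
by rewrite -[leRHS]mulr1 ler_wpM2l.
Qed.

Lemma dual_norm_ge0 w : 0 <= dual_norm w.
Proof. by apply: csup_ge0 => _ [y _ <-]. Qed.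

Lemma dual_normD v w : dual_norm (v + w) <= dual_norm v + dual_norm w.
Proof.
apply: csup_le; first by rewrite addr_ge0 ?dual_norm_ge0.
move=> _ [y /= y1 <-]; apply: le_trans (ler_normD _ _) _.
by rewrite lerD ?dual_norm_ub.
Qed.

Lemma dual_normZ (l : C) w : dual_norm (l *: w) = `|l| * dual_norm w.
Proof.
apply: homog_of_le l w => [l w|]; last exact: dual_norm_ge0.
apply: csup_le; first by rewrite mulr_ge0 ?dual_norm_ge0.
by move=> _ [y /= y1 <-]; rewrite normrM ler_wpM2l // dual_norm_ub.
Qed.

Lemma dual_norm0_eq0 w : dual_norm w = 0 -> w = 0.
Proof.
move=> w0; apply: val_inj; apply/funext => y /=.
have wZ (a : C) u : w (a *: u) = a *: w u.
  by have := dual_lin w a u 0; rewrite dual0 !addr0.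
have [->|y0] := eqVneq y 0.
  by rewrite dual0.
have ny : `|y| != 0 by rewrite normr_eq0.
apply/eqP; rewrite -normr_eq0 -(mulVKf ny `|w y|) mulf_eq0 (negbTE ny) /=.
have -> : `|y|^-1 * `|w y| = `|w (`|y|^-1 *: y)|.
  by rewrite wZ normrM normfV normr_id.
rewrite eq_le normr_ge0 andbT -w0 dual_norm_ub //.
by rewrite normrZ normfV normr_id mulVf.
Qed.

HB.instance Definition _ := Lmodule_isNormed.Build C dual
  dual_normD dual_normZ dual_norm0_eq0.

End dual.

Section dual_subspaces.
Context {R : realType} (Y : normedModType R[i]).
Implicit Type W : submodClosed (dual Y).

Definition separating W : Prop :=
  forall y z : Y, (forall w, w \in W -> w y = w z) -> y = z.

Definition qnorm W (y : Y) : R[i] :=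
  csup [set `|w y| | w in [set w | w \in W /\ `|w| <= 1]].

(* qnorm W is always a seminorm: it is an equivalent norm iff it is bounded
   above and below by positive multiples of the norm of Y. *)
Definition almost_norming W : Prop :=
  exists2 c : R[i], 0 < c & exists2 d : R[i], 0 < d &
    forall y, c * `|y| <= qnorm W y <= d * `|y|.

Lemma almost_norming_separating W : almost_norming W -> separating W.
Proof.
move=> [c c0 [d d0 cd]] y z Wyz; apply/eqP; rewrite -subr_eq0 -normr_eq0.
rewrite eq_le normr_ge0 andbT.
have /andP[+ _] := cd (y - z).
suff -> : qnorm W (y - z) = 0 by rewrite pmulr_rle0.
apply/eqP; rewrite eq_le; apply/andP; split; last first.
  by apply: csup_ge0 => _ [w _ <-].
apply: csup_le => // _ [w [Ww _] <-].
have -> : w (y - z) = w y - w z.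
  by have := dual_lin w (-1) z y; rewrite !scaleN1r addrC => ->; rewrite addrC.
by rewrite Wyz // subrr normr0.
Qed.

End dual_subspaces.

Definition weak {R : realType} (V : normedModType R[i]) : Type :=
  initial_topology
    ((fun v => (fun u : dual V => u v)) : V -> {ptws dual V -> R[i]^o}).

HB.instance Definition _ (R : realType) (V : normedModType R[i]) :=
  Topological.on (weak V).

Definition cunit_ball {R : realType} (V : normedModType R[i]) : set V :=
  [set v | `|v| <= 1].
Arguments cunit_ball {R} V.

Section operators.
Context {R : realType} {U V : normedModType R[i]}.
Implicit Type T : {linear U -> V}.

Definition bounded_operator T : Prop :=
  exists M : R[i], forall u, `|T u| <= M * `|u|.

Definition compact_operator T : Prop := precompact (T @` cunit_ball U).

Definition weakly_compact_operator T : Prop :=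
  precompact (T @` cunit_ball U : set (weak V)).

End operators.

Definition finite_dimensional {R : realType} (V : lmodType R[i]) : Prop :=
  exists (n : nat) (b : 'I_n -> V),
    forall v, exists c : 'I_n -> R[i], v = \sum_(i < n) c i *: b i.

(* A normed space of functions D -> Z, given as a normed space with an
   injective linear realization of its elements as functions. *)
Record function_space {R : realType} (D : Type) (Z : lmodType R[i]) :=
  FunctionSpace {
    fs_space :> normedModType R[i] ;
    fs_fun : {linear fs_space -> (D -> Z)} ;
    fs_inj : injective fs_fun }.
Arguments fs_fun {R D Z} f.

Section operators_between_function_spaces.
Context {R : realType} {D : Type} {Z : lmodType R[i]}.
Variables (op : (D -> Z) -> (D -> Z)) (F1 F2 : function_space D Z).

Definition induces (T : {linear F1 -> F2}) : Prop :=
  forall f, fs_fun F2 (T f) = op (fs_fun F1 f).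

Definition bounded_between : Prop :=
  exists2 T : {linear F1 -> F2}, induces T & bounded_operator T.

Definition compact_between : Prop :=
  exists2 T : {linear F1 -> F2}, induces T & compact_operator T.

Definition weakly_compact_between : Prop :=
  exists2 T : {linear F1 -> F2}, induces T & weakly_compact_operator T.

End operators_between_function_spaces.

(* B_X, with the topology of set_type, the one induced by X. *)
Definition oball {R : realType} (X : normedModType R[i]) : set X :=
  [set x | `|x| < 1].
Arguments oball {R} X.

(* Frechet differentiability over the complex numbers at every point of the
   ball, on which the extension by 0 does not matter. *)
Definition holomorphic {R : realType} {X Z : normedModType R[i]}
    (f : oball X -> Z) : Prop :=
  forall x : oball X, differentiable ('valL_0 f) (\val x).

Record holo_space {R : realType} (X : normedModType R[i]) := HoloSpace {
  hs_space :> completeNormedModType R[i] ;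
  hs_fun : {linear hs_space -> (oball X -> R[i]^o)} ;
  hs_inj : injective hs_fun ;
  hs_holo : forall e, holomorphic (hs_fun e) }.
Arguments hs_fun {R X} h.
Arguments hs_inj {R X} h.

Coercion hs_fs {R : realType} {X : normedModType R[i]} (E : holo_space X) :
    function_space (oball X) R[i]^o :=
  FunctionSpace (hs_inj E).

Section holo_space_properties.
Context {R : realType} {X : normedModType R[i]} (E : holo_space X).

Definition contains_constants : Prop :=
  forall c : R[i], exists e : E, hs_fun E e = cst (c : R[i]^o).

Definition unit_ball_co_compact : Prop :=
  compact (hs_fun E @` cunit_ball E
    : set {compact-open, oball X -> R[i]^o}).

End holo_space_properties.

Section WE.
Context {R : realType} {X Y : normedModType R[i]}.
Variables (W : submodClosed (dual Y)) (E : holo_space X).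
Local Notation C := R[i].

(* The norms of the w \o f, for w in the unit ball of W. *)
Definition WE_norms (f : oball X -> Y) : set C :=
  [set r | exists (w : dual Y) (e : E),
     [/\ w \in W, `|w| <= 1, hs_fun E e = w \o f & r = `|e|] ].

Definition WE_fnorm (f : oball X -> Y) : C := csup (WE_norms f).

(* The last condition says that the supremum defining the norm is finite.  By
   the closed graph theorem it follows from the second one when W is closed in
   the dual of Y and point evaluations are continuous on E.  It does not follow
   for arbitrary W: in Y = l^2, with W the finitely supported sequences and
   E = H^oo of the unit disc, take f z = (n z^n)_n. *)
Definition WE_pred : {pred oball X -> Y} := fun f =>
  `[< [/\ forall x : oball X, bounded_near f (nbhs x),
          forall w, w \in W -> exists e : E, hs_fun E e = (w \o f : _ -> C^o) &
          exists M : C, forall r, WE_norms f r -> r <= M] >].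

Lemma WE_norms_comb (a : C) f g M N :
  (forall w, w \in W -> exists e : E, hs_fun E e = (w \o f : _ -> C^o)) ->
  (forall w, w \in W -> exists e : E, hs_fun E e = (w \o g : _ -> C^o)) ->
  (forall r, WE_norms f r -> r <= M) -> (forall r, WE_norms g r -> r <= N) ->
  forall r, WE_norms (a *: f + g) r -> r <= `|a| * M + N.
Proof.
move=> Wf Wg fM gN r [w [e [Ww w1 ew ->]]].
have [e1 e1w] := Wf _ Ww; have [e2 e2w] := Wg _ Ww.
have -> : e = a *: e1 + e2.
  apply: (hs_inj E); rewrite linearP /= ew e1w e2w; apply/funext => x.
  by rewrite /= dual_lin.
apply: le_trans (ler_normD _ _) _; rewrite normrZ lerD //.
  by rewrite ler_wpM2l //; apply: fM; exists w, e1.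
by apply: gN; exists w, e2.
Qed.

Lemma WE_pred_submod : submod_closed WE_pred.
Proof.
split.
  apply/asboolP; split.
  - move=> x; exists 0; split => // M M0; near=> y.
    by rewrite /= [X in `|X|](_ : _ = 0) // normr0 ltW.
  - move=> w _; exists 0; rewrite linear0; apply/funext => x /=.
    by rewrite dual0.
  - exists 0 => r [w [e [_ _ ew ->]]]; have -> : e = 0; last by rewrite normr0.
    apply: (hs_inj E); rewrite linear0 ew; apply/funext => x /=.
    by rewrite dual0.
move=> a f g /asboolP[bf Wf [M fM]] /asboolP[bg Wg [N gN]].
apply/asboolP; split.
- move=> x.
  have [A [Ar fA]] := bf x; have [B [Br gB]] := bg x.
  exists (`|a| * (`|A| + 1) + (`|B| + 1)); split.
    by rewrite realD ?realM ?realD ?normr_real ?real1.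
  move=> D ltD.
  have hA : \forall y \near x, `|f y| <= `|A| + 1.
    by apply: fA; rewrite (le_lt_trans (real_ler_norm Ar)) // ltrDl.
  have hB : \forall y \near x, `|g y| <= `|B| + 1.
    by apply: gB; rewrite (le_lt_trans (real_ler_norm Br)) // ltrDl.
  move: hA hB; apply: filterS2 => y fy gy; apply: le_trans (ltW ltD).
  rewrite !fctE; apply: le_trans (ler_normD _ _) _.
  by rewrite normrZ lerD // ler_wpM2l.
- move=> w Ww; have [e1 e1w] := Wf _ Ww; have [e2 e2w] := Wg _ Ww.
  exists (a *: e1 + e2); rewrite linearP /= e1w e2w; apply/funext => x.
  by rewrite /= dual_lin.
- by exists (`|a| * M + N); exact: WE_norms_comb.
Unshelve. all: by end_near. Qed.

HB.instance Definition _ :=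
  GRing.isSubmodClosed.Build C (oball X -> Y) WE_pred WE_pred_submod.

Lemma WE_norms_ge0 f r : WE_norms f r -> 0 <= r.
Proof. by move=> [w [e [_ _ _ ->]]]. Qed.

Lemma WE_fnorm_ub f r : f \in WE_pred -> WE_norms f r -> r <= WE_fnorm f.
Proof.
move=> /asboolP[_ _ [M fM]]; apply: csup_ub fM => t /WE_norms_ge0.
exact: ger0_real.
Qed.

Lemma WE_fnorm_ge0 f : 0 <= WE_fnorm f.
Proof. by apply: csup_ge0 => t /WE_norms_ge0. Qed.

Lemma WE_fnorm_comb (a : C) f g : f \in WE_pred -> g \in WE_pred ->
  WE_fnorm (a *: f + g) <= `|a| * WE_fnorm f + WE_fnorm g.
Proof.
move=> Ef Eg; have /asboolP[_ Wf _] := Ef; have /asboolP[_ Wg _] := Eg.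
apply: csup_le; first by rewrite addr_ge0 ?mulr_ge0 ?WE_fnorm_ge0.
apply: WE_norms_comb => // r; exact: WE_fnorm_ub.
Qed.

(* The proof that W is separating is only used to make the norm definite. *)
Record WE_space (sepW : separating W) :=
  WESpace { WE_val :> oball X -> Y ; _ : WE_val \in WE_pred }.

Variable sepW : separating W.

HB.instance Definition _ := [isSub for @WE_val sepW].
HB.instance Definition _ := [Choice of WE_space sepW by <:].
HB.instance Definition _ := [SubChoice_isSubLmodule of WE_space sepW by <:].

Definition WE_norm (f : WE_space sepW) : C := WE_fnorm f.

Lemma WE_normD f g : WE_norm (f + g) <= WE_norm f + WE_norm g.
Proof.
have := WE_fnorm_comb 1 (valP f) (valP g).
by rewrite scale1r normr1 mul1r.
Qed.

Lemma WE_normZ (l : C) f : WE_norm (l *: f) = `|l| * WE_norm f.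
Proof.
apply: homog_of_le l f => [l f|f]; last exact: WE_fnorm_ge0.
have := WE_fnorm_comb l (valP f) (rpred0 WE_pred); rewrite addr0.
suff -> : WE_fnorm 0 = 0 by rewrite addr0.
apply/eqP; rewrite eq_le WE_fnorm_ge0 andbT.
apply: csup_le => // r [w [e [_ _ ew ->]]].
have -> : e = 0; last by rewrite normr0.
apply: (hs_inj E); rewrite linear0 ew; apply/funext => x /=.
by rewrite dual0.
Qed.

Lemma WE_norm0_eq0 f : WE_norm f = 0 -> f = 0.
Proof.
move=> f0; apply: val_inj; apply/funext => x; apply: sepW => w Ww.
change (w (val f x) = w 0); rewrite dual0.
have /asboolP[_ Wf _] := valP f.
have [->|w0] := eqVneq w 0; first by [].
have nw : `|w| != 0 by rewrite normr_eq0.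
have [e ew] := Wf w Ww.
suff e0 : e = 0.
  by move/(congr1 (fun h => h x)): ew; rewrite e0 linear0 /= => <-.
pose v := `|w|^-1 *: w; pose ev := `|w|^-1 *: e.
suff /eqP : ev = 0 by rewrite scaler_eq0 invr_eq0 (negbTE nw) => /eqP.
apply/eqP; rewrite -normr_eq0 eq_le normr_ge0 andbT -f0.
apply: WE_fnorm_ub; first exact: (valP f).
exists v, ev; split=> //; first exact: rpredZ.
  by rewrite normrZ normfV normr_id mulVf.
by rewrite /ev linearZ /= ew.
Qed.

HB.instance Definition _ := Lmodule_isNormed.Build C (WE_space sepW)
  WE_normD WE_normZ WE_norm0_eq0.

End WE.

(* WE(Y), as a normed space of functions on the ball. *)
Definition WE {R : realType} {X Y : normedModType R[i]}
    {W : submodClosed (dual Y)} (sepW : separating W) (E : holo_space X) :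
    function_space (oball X) Y :=
  FunctionSpace (val_inj : injective (\val : {linear WE_space E sepW -> _})).

Definition wcomp {R : realType} {X Z : normedModType R[i]}
    (psi : oball X -> R[i]^o) (phi : oball X -> oball X)
    (f : oball X -> Z) : oball X -> Z :=
  fun x => psi x *: f (phi x).

(* Main.v *)
From HB Require Import structures.
Require Import Defs.
From mathcomp Require Import all_boot all_order all_algebra.
From mathcomp Require Import complex ring.
From mathcomp Require Import all_classical all_reals all_analysis.

Import Order.TTheory GRing.Theory Num.Theory.
Import numFieldNormedType.Exports.

Set Implicit Arguments.
Unset Strict Implicit.
Unset Printing Implicit Defensive.

Local Open Scope classical_set_scope.
Local Open Scope ring_scope.
Local Open Scope complex_scope.

(* Part (1): composing with elements of W reduces the vector-valued operator to
   the scalar one, and conversely the functions [x |-> f x *: y] with w y <> 0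
   embed E1 into WE1(Y).

   Part (2): write T and T' for the scalar and the vector-valued operator.
   Since T is compact, for every d > 0 there are finitely many points x and a
   constant m such that |T h| <= d |h| + m * sum_x |(T h) x|, and testing
   against the unit ball of W gives the same estimate for T'.  Along an
   ultrafilter on the unit ball of WE1(Y) that converges pointwise (weakly, if
   the unit ball of Y is only weakly compact), the limit g stays in the unit
   ball because that of E1 is closed under pointwise limits.  In the compact
   case the estimate gives T' f --> T' g at once.  In the weakly compact case, a
   functional composed with T' is dominated by d |f| plus multiples of
   |(T' f) x|, so by Hahn-Banach it is, up to d |f|, a sum of functionals of
   the values (T' f) x, which converge.  Conversely, the identity of Y factors
   through T' by way of constant functions and the evaluation at a point where
   psi does not vanish. *)

(** * Complex scalars and functionals *)

Lemma ReK {R : realType} (z : R[i]) : 0 <= z -> z = (complex.Re z)%:C.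
Proof. by move=> z0; rewrite RRe_real // ger0_real. Qed.

Lemma Re_le_norm {R : realType} (z : R[i]) : `|complex.Re z|%:C <= `|z|.
Proof.
rewrite [leRHS]ReK // lecR; case: z => a b /=.
by rewrite -sqrtr_sqr ler_wsqrtr // lerDl sqr_ge0.
Qed.

Lemma norm_real_complex {R : realType} (x : R) : `|x%:C| = `|x|%:C :> R[i].
Proof. by rewrite normc_def /= expr0n addr0 sqrtr_sqr. Qed.

(** The four real parts are those of [z] and its multiples by powers of ['i], that is, plus or minus
    the real and the imaginary part of [z]. One-sided bounds on real functionals thus control a
    complex modulus. *)
Lemma norm_le_of_Re {R : realType} (z : R[i]) (d : R) :
  complex.Re z <= d -> complex.Re (- 1 * z) <= d ->
  complex.Re ('i * z) <= d -> complex.Re (- 'i * z) <= d ->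
  `|z| <= (d + d)%:C.
Proof.
case: z => a b h1 h2 h3 h4.
have [a1 a2 b1 b2] : [/\ a <= d, - a <= d, - b <= d & b <= d].
  by move: h1 h2 h3 h4; rewrite -complexiE; simpc => /= *; split.
rewrite (_ : a +i* b = a%:C + 'i%C * b%:C); last first.
  by apply/eqP; rewrite eq_complex /=; simpc.
apply: le_trans (ler_normD _ _) _.
rewrite normrM complexiE normCi mul1r !norm_real_complex.
by rewrite rmorphD lerD // lecR ler_norml ?a1 ?b2 andbT lerNl.
Qed.

Lemma archiC {R : realType} (z : R[i]) : 0 <= z -> exists n : nat, z <= n%:R.
Proof.
move=> z0; have := z0; rewrite {1}(ReK z0) (lecR 0) => /archi_boundP zn.
exists (Num.bound (complex.Re z)); rewrite [leLHS]ReK //.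
by rewrite -(rmorph_nat (real_complex R)) /= lecR ltW.
Qed.

(** The order of [R[i]] is partial, so the bound is first proved up to a real [e > 0], and [e] is
    removed after passing to real parts. *)
Lemma cvg_norm_le {R : realType} {V : normedModType R[i]} {T : Type}
    (F : set_system T) {FF : ProperFilter F} (f : T -> V) (l : V) (M : R[i]) :
  f @ F --> l -> (\forall t \near F, `|f t| <= M) -> `|l| <= M.
Proof.
move=> fl fM.
have [t tM] := filter_ex fM; have M0 : 0 <= M by apply: le_trans tM.
have {tM} h (e : R) : 0 < e -> `|l| <= M + e%:C.
  move=> e0; have eC : 0 < e%:C :> R[i] by rewrite (ltcR 0).
  move: fl => /cvgrPdist_le /(_ _ eC) fl.
  have [s [/= ls sM]] := filter_ex (filterI fl fM).
  by rewrite -(subrK (f s) l) addrC (le_trans (ler_normD _ _)) // lerD.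
rewrite [leLHS]ReK // [leRHS]ReK // lecR; apply/ler_addgt0Pr => e e0.
by rewrite -lecR rmorphD /= -!ReK ?h.
Qed.

Lemma closed_norm_le {R : realType} {V : normedModType R[i]} (M : R[i]) :
  closed [set v : V | `|v| <= M].
Proof.
move=> v /= cv.
set A := [set v : V | _] in cv *.
have FF : ProperFilter (within A (nbhs v)) by exact: within_nbhs_proper.
have FA : within A (nbhs v) A by exact: withinT.
exact: (@cvg_norm_le _ _ _ (within A (nbhs v)) FF id _ _ (cvg_within _) FA).
Qed.

(** The disc is a closed subset of the continuous image of a compact square of the real plane. *)
Lemma disc_compact {R : realType} (M : R[i]) :
  compact [set z : R[i]^o | `|z| <= M].
Proof.
(* When [0 <= M] fails, in particular when [M] is not real, no norm is below [M] and the disc is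
   empty. *)
have [M0|/negP M0] := boolP (0 <= M); last first.
  rewrite (_ : mkset _ = set0); first exact: compact0.
  by rewrite -subset0 => z zM; apply: M0; apply: le_trans zM.
pose r := complex.Re M.
pose f (p : R * R) : R[i]^o := Complex p.1 p.2.
have cf : continuous f.
  move=> p; apply/cvgrPdist_le => /= e e0.
  have [d d0 eE] : exists2 d, 0 < d & e = d%:C.
    have eE := ReK (ltW e0); exists (complex.Re e) => //.
    by rewrite -ltcR -eE.
  have d20 : 0 < d / 2 by rewrite divr_gt0.
  have h1 : \forall q \near p, `|p.1 - q.1| <= d / 2.
    have : (fun q : R * R => q.1) @ p --> p.1 by exact: cvg_fst.
    by move/cvgrPdist_le => /(_ _ d20).
  have h2 : \forall q \near p, `|p.2 - q.2| <= d / 2.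
    have : (fun q : R * R => q.2) @ p --> p.2 by exact: cvg_snd.
    by move/cvgrPdist_le => /(_ _ d20).
  move: h1 h2; apply: filterS2 => q h1 h2.
  rewrite eE (_ : f p - f q = (p.1 - q.1)%:C + 'i * (p.2 - q.2)%:C); last first.
    by rewrite -complexiE /f; apply/eqP; rewrite eq_complex /=; simpc.
  apply: le_trans (ler_normD _ _) _; rewrite normrM normCi mul1r.
  by rewrite !norm_real_complex -rmorphD /= lecR [leRHS]splitr lerD.
have K : compact (f @` (`[- r, r] `*` `[- r, r])).
  apply: continuous_compact; first exact: continuous_subspaceT.
  by apply: compact_setX; exact: segment_compact.
apply: subclosed_compact K _.
  exact: closed_norm_le.
move=> [a b] /= zM; exists (a, b) => //=.
rewrite !in_itv /= -!ler_norml -!lecR -(ReK M0).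
split; apply: le_trans zM; rewrite normc_def lecR /= -sqrtr_sqr ler_wsqrtr //.
  by rewrite lerDl sqr_ge0.
by rewrite lerDr sqr_ge0.
Qed.

Section dual_operations.
Context {R : realType} {Y : normedModType R[i]}.
Implicit Types (w : dual Y) (y z : Y).

Lemma dualZ w (a : R[i]) y : w (a *: y) = a * w y.
Proof. by have := dual_lin w a y 0; rewrite dual0 !addr0. Qed.

Lemma dualD w y z : w (y + z) = w y + w z.
Proof. by have := dual_lin w 1 y z; rewrite !scale1r. Qed.

Lemma dualB w y z : w (y - z) = w y - w z.
Proof. by rewrite dualD -scaleN1r dualZ mulN1r. Qed.

End dual_operations.

(** * Finite dimension *)

Section finite_dimension.
Context {R : realType} {V : normedModType R[i]}.
Implicit Types (s : seq V) (M : R[i]).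

(** The span is built one generator at a time, which is the induction used for the compactness of
    its balls. *)
Fixpoint spanset s : set V :=
  if s is v :: s' then [set p.1 + p.2 *: v | p in spanset s' `*` [set: R[i]]]
  else [set 0].

Lemma spanset0 s : spanset s 0.
Proof.
elim: s => [//|v s IH] /=; exists (0, 0) => //=.
by rewrite scale0r addr0.
Qed.

Lemma spanset_comb s (a : R[i]) u v :
  spanset s u -> spanset s v -> spanset s (a *: u + v).
Proof.
elim: s u v => [|w s IH] u v /=.
  by move=> -> ->; rewrite scaler0 addr0.
move=> [[x b] /= [sx _] <-] [[y c] /= [sy _] <-].
exists (a *: x + y, a * b + c) => /=; first by split=> //; exact: IH.
by rewrite scalerDr scalerDl scalerA addrACA.
Qed.

Lemma spansetZ s (a : R[i]) u : spanset s u -> spanset s (a *: u).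
Proof. by move=> su; rewrite -[_ *: _]addr0; exact: spanset_comb (spanset0 _). Qed.

Lemma spansetD s u v : spanset s u -> spanset s v -> spanset s (u + v).
Proof. by move=> su sv; rewrite -[u]scale1r; exact: spanset_comb. Qed.

Lemma mem_spanset s v : v \in s -> spanset s v.
Proof.
elim: s => [//|w s IH]; rewrite inE => /orP[/eqP ->|vs] /=.
  by exists (0, 1); rewrite ?add0r ?scale1r //=; split=> //; exact: spanset0.
by exists (v, 0); rewrite ?scale0r ?addr0 //=; split=> //; exact: IH.
Qed.

Lemma spanset_sum s v : spanset s v ->
  exists c : nat -> R[i], v = \sum_(i < size s) c i *: s`_i.
Proof.
elim: s v => [|w s IH] v /=; first by move=> ->; exists (fun=> 0); rewrite big_ord0.
move=> [[x a] /= [/IH [c ->] _] <-].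
exists (fun n => if n is n'.+1 then c n' else a).
by rewrite big_ord_recl /= addrC.
Qed.

Lemma finite_dimensionalP :
  finite_dimensional V <-> exists s, spanset s = setT.
Proof.
split=> [[n [b bP]]|[s sT]].
  exists [seq b i | i <- enum 'I_n]; apply/seteqP; split=> // v _.
  have [c ->] := bP v; elim/big_ind: _ => [||i _]; first exact: spanset0.
    by move=> *; exact: spansetD.
  by apply/spansetZ/mem_spanset/map_f; rewrite mem_enum.
exists (size s), (fun i => s`_i) => v.
have [|c ->] := @spanset_sum s v; first by rewrite sT.
by exists (fun i => c i).
Qed.

(** A point [v] of the closure is already in the closure of the part of [A] of norm at most
    [|v| + 1], which is compact and so closed. *)
Lemma closed_of_compact_balls (A : set V) :
  (forall M, compact (A `&` [set v | `|v| <= M])) -> closed A.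
Proof.
move=> cA v clAv; have := cA (`|v| + 1) => /(compact_closed (@norm_hausdorff _ _)).
suff : closure (A `&` [set u | `|u| <= `|v| + 1]) v by move=> h /(_ v h) [].
move=> B vB; have v1 : nbhs v [set u | `|u| <= `|v| + 1].
  have := @cvgrPdist_le _ _ _ (nbhs v) _ id v.
  move=> [/(_ (fun _ => id)) /(_ 1 ltr01) h _].
  apply: filterS h => u /= uv.
  by rewrite -(subrKC v u) (le_trans (ler_normD _ _)) // lerD // distrC.
have [u [Au [/= u1 Bu]]] := clAv _ (filterI v1 vB).
by exists u.
Qed.

Lemma closed_dist (A : set V) v : closed A -> ~ A v ->
  exists2 d : R[i], 0 < d & forall u, A u -> d <= `|v - u|.
Proof.
move=> cA Av; have : nbhs v (~` A).
  by apply: open_nbhs_nbhs; split => //; exact: closed_openC.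
move=> /nbhs_ballP[d /= d0 dA]; exists d => // u Au.
rewrite real_leNgt ?normr_real ?gtr0_real //; apply/negP => vu.
by apply: (dA u) => //; rewrite -ball_normE.
Qed.

(** Induction on the generators. If [w] is outside the span of [s], which is closed by induction,
    its distance [d > 0] to that span gives [|a| * d <= |x + a *: w|]. Both coordinates are then
    bounded, and the ball is a closed part of the image of a product of compact sets. *)
Lemma spanset_compact s M : compact (spanset s `&` [set v | `|v| <= M]).
Proof.
elim: s M => [|w s IH] M.
  rewrite /= setIC; apply: subclosed_compact (@compact_set1 _ 0) (@subIsetr _ _ _).
  apply: closedI; first exact: closed_norm_le.
  by apply: compact_closed; [exact: norm_hausdorff|exact: compact_set1].
have cs : closed (spanset s) by exact: closed_of_compact_balls.
have [ws|ws] := pselect (spanset s w).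
  rewrite (_ : spanset (w :: s) = spanset s) //; apply/seteqP; split=> [v|v sv].
    by move=> [[x a] [/= sx _] <-]; apply: spansetD => //; exact: spansetZ.
  by exists (v, 0); rewrite /= ?scale0r ?addr0.
have [d d0 dP] := closed_dist cs ws.
have ds x (a : R[i]) : spanset s x -> `|a| * d <= `|x + a *: w|.
  move=> sx; have [->|a0] := eqVneq a 0; first by rewrite normr0 mul0r.
  have -> : x + a *: w = a *: (w - (- a^-1 *: x)).
    by rewrite scaleNr opprK scalerDr scalerA divff // scale1r addrC.
  by rewrite normrZ ler_wpM2l //; apply: dP; exact: spansetZ.
pose g (p : V * R[i]^o) : V := p.1 + p.2 *: w.
have cg : continuous g.
  move=> p; apply: cvgD; first exact: cvg_fst.
  by apply: cvgZr_tmp; exact: cvg_snd.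
(* If [|x + a *: w| <= M] and [|a| <= M / d], then [|x|] is at most [M + M / d * |w|]. *)
have K : compact (g @` ((spanset s `&` [set v | `|v| <= M + M / d * `|w|])
    `*` [set a : R[i]^o | `|a| <= M / d])).
  apply: continuous_compact; first exact: continuous_subspaceT.
  by apply: compact_setX => //; exact: disc_compact.
have := compact_closedI K (@closed_norm_le _ V M).
congr compact; apply/seteqP; split=> v [+ vM].
  by move=> [[x a] [/= [sx _] _] xav]; split=> //; exists (x, a).
move=> [[x a] [/= sx _] xav]; split=> //; exists (x, a) => //=.
have aM : `|a| <= M / d.
  by rewrite ler_pdivlMr // (le_trans (ds x a sx)) // xav.
split=> //; split=> //.
rewrite -(addrK (a *: w) x) xav (le_trans (ler_normB _ _)) // lerD //.
by rewrite normrZ ler_wpM2r.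
Qed.

Lemma spanset_closed s : closed (spanset s).
Proof. by apply: closed_of_compact_balls => M; exact: spanset_compact. Qed.

(** Riesz's argument: finitely many balls of radius 1/2 cover the unit ball, and iterating shows
    that their centres span a dense subspace, which is also closed. *)
Lemma compact_idfun_finite_dimensional :
  compact_operator (idfun : {linear V -> V}) <-> finite_dimensional V.
Proof.
rewrite finite_dimensionalP /compact_operator image_id; split; last first.
  move=> [s sT]; exists (cunit_ball V) => //.
  split; last exact: closed_norm_le.
  by have := @spanset_compact s 1; rewrite sT setTI.
have half_gt0 : 0 < 2^-1 :> R[i] by rewrite invr_gt0 ltr0n.
move=> [K BK [+ _]]; rewrite compact_cover => /(_ V setT (fun v => ball v 2^-1)).
case=> [v _|v _|D _ KD]; first exact: ball_open.
  by exists v => //; exact: ballxx.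
exists (finmap.enum_fset D); apply/seteqP; split=> // v _.
have step u : `|u| <= 1 ->
    exists2 b, spanset (finmap.enum_fset D) b & `|u - b| <= 2^-1.
  move=> /BK /KD [b /= Db ub]; exists b; first exact: mem_spanset.
  by apply: ltW; move: ub; rewrite -ball_normE /= distrC.
(* The error [u - b] has norm at most 1/2, so [2 *: (u - b)] is in the unit ball again and can be
   approximated in turn. *)
have approx n u : `|u| <= 1 ->
    exists2 b, spanset (finmap.enum_fset D) b & `|u - b| <= 2^-1 ^+ n.
  elim: n u => [|n IH] u u1.
    by exists 0; [exact: spanset0|rewrite subr0 expr0].
  have [b sb ub] := step u u1.
  have [|c sc uc] := IH (2 *: (u - b)).
    by rewrite normrZ normr_nat -ler_pdivlMl ?ltr0n // mulr1.
  exists (2^-1 *: c + b); first exact: spanset_comb.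
  rewrite (addrC _ b) opprD addrA exprS -(ler_pdivrMl _ _ half_gt0) invrK.
  rewrite -[X in X * _](@normr_nat R[i]) -normrZ scalerBr scalerA.
  by rewrite divff ?scale1r ?pnatr_eq0 //.
have [->|v0] := eqVneq v 0; first exact: spanset0.
have nv0 : `|v| != 0 by rewrite normr_eq0.
rewrite -[v](scalerKV nv0); apply: spansetZ; apply: spanset_closed.
set u := _ *: v; have u1 : `|u| <= 1.
  by rewrite normrZ normfV normr_id mulVf.
move=> B /nbhs_ballP[e /= e0 eB].
have [n en] := archiC (ltW (divr_gt0 ltr01 e0)).
have [b sb ub] := approx n u u1; exists b; split=> //; apply: eB.
rewrite -ball_normE /=; apply: le_lt_trans ub _.
rewrite exprVn invf_plt ?posrE ?exprn_gt0 ?ltr0n //.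
rewrite -div1r (le_lt_trans en) // -natrX ltr_nat.
exact: ltn_expl.
Qed.

End finite_dimension.

(** * Hahn-Banach theorem *)

Section sublinear.
Context {R : realType} {V : lmodType R[i]}.
Implicit Types (P Q l : V -> R).

(** Only real scalars occur: functionals are extended over the reals and made complex in
    [real_functional_dual]. The inequality for [t > 0] implies equality, by applying it to
    [t^-1]. *)
Definition sublinear P :=
  (forall x y, P (x + y) <= P x + P y) /\
  (forall (t : R) x, 0 < t -> P (t%:C *: x) <= t * P x).

Definition real_linear l :=
  (forall x y, l (x + y) = l x + l y) /\
  (forall (t : R) x, l (t%:C *: x) = t * l x).

Lemma sublinearZ P : sublinear P ->
  forall (t : R) x, 0 < t -> P (t%:C *: x) = t * P x.
Proof.
move=> [_ PZ] t x t0; apply/eqP; rewrite eq_le PZ //=.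
rewrite -ler_pdivlMl //; have tn0 : t != 0 by rewrite gt_eqF.
apply: le_trans (PZ _ _ _); last by rewrite invr_gt0.
by rewrite scalerA -rmorphM /= mulVf // scale1r.
Qed.

Lemma sublinear0 P : sublinear P -> P 0 = 0.
Proof.
move=> /sublinearZ PZ; have := PZ 2 0; rewrite scaler0 ltr0n => /(_ isT) h.
by apply: (@addrI _ (P 0)); rewrite addr0 -mulr2n -mulr_natl -h.
Qed.

Lemma sublinear_ge P : sublinear P -> forall x, - P (- x) <= P x.
Proof.
by move=> sP x; rewrite lerNl -subr_ge0 opprK -(sublinear0 sP) -(subrr x) addrC sP.1.
Qed.

Lemma sublinearD P Q : sublinear P -> sublinear Q -> sublinear (P \+ Q).
Proof.
move=> [PD PZ] [QD QZ]; split => [x y|t x t0] /=.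
  by rewrite addrACA lerD.
by rewrite mulrDr lerD // ?PZ ?QZ.
Qed.

Lemma real_linear_sublinear l : real_linear l -> sublinear l.
Proof. by move=> [lD lZ]; split=> [x y|t x _]; rewrite ?lD ?lZ. Qed.

Lemma real_linearN l : real_linear l -> forall x, l (- x) = - l x.
Proof. by move=> [_ lZ] x; rewrite -scaleN1r -(rmorphN1 (real_complex R)) lZ mulN1r. Qed.

(** The minorant [m] makes the pointwise infimum finite. As [k] may depend on the indices and the
    vectors, the lemma covers chains of functionals as well as families indexed by scalars or
    vectors. *)
Lemma sublinear_inf (I : Type) (i0 : I) (g : I -> V -> R) (m : V -> R) :
  (forall i x, m x <= g i x) ->
  (forall i j x y, exists k, g k (x + y) <= g i x + g j y) ->
  (forall i (t : R) x, 0 < t -> exists k, g k (t%:C *: x) <= t * g i x) ->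
  exists2 Q, sublinear Q & forall i x, Q x <= g i x.
Proof.
move=> gm gD gZ; pose Q x := inf [set g i x | i in [set: I]].
have Qg i x : Q x <= g i x.
  by apply: ge_inf; [exists (m x) => _ [j _ <-]|exists i].
have gQ x a : (forall i, a <= g i x) -> a <= Q x.
  move=> ag; apply: lb_le_inf; first by exists (g i0 x), i0.
  by move=> _ [i _ <-].
exists Q => //; split=> [x y|t x t0].
  rewrite -lerBlDr; apply: (gQ) => i; rewrite lerBlDr [leRHS]addrC -lerBlDr.
  apply: gQ => j; rewrite lerBlDr [leRHS]addrC; have [k] := gD i j x y.
  exact: le_trans.
rewrite -ler_pdivrMl //; apply: gQ => i; rewrite ler_pdivrMl //.
by have [k] := gZ i t x t0; exact: le_trans.
Qed.

(* A minimal sublinear functional is linear, for otherwise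
   [y |-> inf_t (Q (y + t x) - t Q x)] is a smaller one. *)
Lemma hahn_banach P : sublinear P ->
  exists2 l, real_linear l & forall x, l x <= P x.
Proof.
move=> sP; pose T := {Q | sublinear Q /\ forall x, Q x <= P x}.
pose P0 : T := exist _ P (conj sP (fun x => lexx (P x))).
(* The order is reversed, so that a maximal element for Zorn's lemma is a minimal sublinear
   functional. *)
pose le (Q Q' : T) := `[< forall x, sval Q' x <= sval Q x >].
have [||||[Q [sQ QP]] Qmin] := @Zorn T le.
- by move=> Q; apply/asboolP.
- move=> Q1 Q2 Q3 /asboolP h1 /asboolP h2; apply/asboolP => x.
  exact: le_trans (h2 x) (h1 x).
- move=> [Q1 ?] [Q2 ?] /asboolP h1 /asboolP h2; apply: eq_exist.
  by apply/funext => x; apply/le_anti; rewrite h1 h2.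
- move=> A totA; have [[Q0 AQ0]|A0] := pselect (exists r, A r); last first.
    by exists P0 => Q AQ; exfalso; apply: A0; exists Q.
  pose g (q : {q : T | A q}) := sval (sval q).
  (* Each sublinear [q <= P] satisfies [q x >= - q (- x) >= - P (- x)], so the infimum over the
     chain is finite. *)
  have [|||Q sQ Qg] := @sublinear_inf _ (exist _ Q0 AQ0) g (fun x => - P (- x)).
  + move=> [[q [sq qP]] Aq] x /=; apply: le_trans (sublinear_ge sq x).
    by rewrite lerN2.
  + move=> [q Aq] [q' Aq'] x y; have [/asboolP qq|/asboolP qq] := totA _ _ Aq Aq'.
      exists (exist _ q' Aq'); apply: le_trans ((svalP q').1.1 x y) _.
      by rewrite lerD.
    exists (exist _ q Aq); apply: le_trans ((svalP q).1.1 x y) _.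
    by rewrite lerD.
  + by move=> q t x t0; exists q; exact: (svalP (sval q)).1.2.
  have QP x : Q x <= P x.
    exact: le_trans (Qg (exist _ Q0 AQ0) x) ((svalP Q0).2 x).
  exists (exist _ Q (conj sQ QP)) => q Aq; apply/asboolP => x /=.
  exact: (Qg (exist _ q Aq)).
have Qadd x y : Q y <= Q (y + x) - Q x.
  pose g (t : {t : R | 0 <= t}) y := Q (y + (sval t)%:C *: x) - sval t * Q x.
  have tQ (t : R) : 0 <= t -> Q (t%:C *: x) = t * Q x.
    rewrite le_eqVlt => /predU1P[<-|t0]; last exact: sublinearZ.
    by rewrite scale0r mul0r (sublinear0 sQ).
  have [|||Q' sQ' Q'g] := @sublinear_inf _ (exist _ 0 (lexx 0)) g (fun y => - Q (- y)).
  - move=> [t t0] z; rewrite /g /= lerBrDr addrC lerBlDr -tQ //.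
    by have := sQ.1 (z + t%:C *: x) (- z); rewrite addrAC subrr add0r.
  - move=> [t t0] [s s0] z z'; exists (exist _ (t + s) (addr_ge0 t0 s0)).
    rewrite /g /= rmorphD /= scalerDl addrACA mulrDl opprD [leRHS]addrACA.
    by rewrite lerD2r; exact: sQ.1.
  - move=> [s s0] t z t0; exists (exist _ (t * s) (mulr_ge0 (ltW t0) s0)).
    rewrite /g /= rmorphM /= -scalerA -scalerDr -mulrA mulrBr.
    by rewrite lerD2r sQ.2.
  (* The index [t = 0] gives [Q' <= Q], hence [Q' = Q] by minimality; the index [t = 1] then gives
     the claim. *)
  have Q'Q z : Q' z <= Q z.
    by have := Q'g (exist _ 0 (lexx 0)) z; rewrite /g /= scale0r addr0 mul0r subr0.
  have Q'P z : Q' z <= P z by exact: le_trans (QP z).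
  have := Qmin (exist _ Q' (conj sQ' Q'P)) => /= h.
  have /(congr1 (fun r : T => sval r y)) /= <- :
      exist _ Q' (conj sQ' Q'P) = exist _ Q (conj sQ QP) :> T.
    by apply: h; apply/asboolP.
  by have := Q'g (exist _ 1 ler01) y; rewrite /g /= scale1r mul1r.
have QD x y : Q (x + y) = Q x + Q y.
  by apply/eqP; rewrite eq_le sQ.1 /= -lerBrDr Qadd.
have QN x : Q (- x) = - Q x.
  by apply/eqP; rewrite -addr_eq0 -QD addrC subrr; apply/eqP; exact: sublinear0.
exists Q => //; split=> // t x; have [t0|t0|<-] := ltgtP 0 t.
- exact: sublinearZ.
- have := @sublinearZ _ sQ (- t) x; rewrite oppr_gt0 => /(_ t0).
  by rewrite rmorphN /= scaleNr QN mulNr => /oppr_inj.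
- by rewrite scale0r mul0r (sublinear0 sQ).
Qed.

End sublinear.

(* The Hahn-Banach theorem is applied to the largest sublinear functional that
   every admissible [l] has to minorize. *)
Lemma sublinear_split {R : realType} {V Z : lmodType R[i]} (S : {linear V -> Z})
    (p lam : V -> R) (q : Z -> R) :
  sublinear p -> sublinear q -> real_linear lam ->
  (forall v, lam v <= p v + q (S v)) ->
  exists2 l : Z -> R, real_linear l /\ (forall z, l z <= q z) &
    forall v, lam v <= p v + l (S v).
Proof.
move=> sp sq rl lpq; pose g v z := q (z + S v) + p v - lam v.
have [|||P sP Pg] := @sublinear_inf _ _ _ 0 g (fun z => - q (- z)).
- move=> v z; rewrite /g lerBrDr addrC lerBlDr; apply: le_trans (lpq v) _.
  rewrite addrAC [leRHS]addrC lerD2l.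
  by have := sq.1 (z + S v) (- z); rewrite addrAC subrr add0r.
- move=> v v' z z'; exists (v + v').
  rewrite /g linearD addrACA rl.1 opprD [leRHS]addrACA lerD2r.
  rewrite [leRHS]addrACA lerD //; [exact: sq.1|exact: sp.1].
- move=> v t z t0; exists (t%:C *: v).
  rewrite /g linearZ /= -scalerDr rl.2 mulrBr lerD2r mulrDr.
  by rewrite lerD //; [exact: sq.2|exact: sp.2].
have [l rl' lP] := hahn_banach sP.
exists l => [|v].
  split=> // z; apply: le_trans (lP z) _; apply: le_trans (Pg 0 z) _.
  rewrite /g linear0 addr0 (sublinear0 sp) addr0 (sublinear0 _) ?subr0 //.
  exact: real_linear_sublinear.
(* At [z = - S v] the term in [q] vanishes, which leaves [l (- S v) <= p v - lam v]. *)
have := le_trans (lP (- S v)) (Pg v _).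
rewrite /g addNr (sublinear0 sq) add0r real_linearN // lerBrDr.
by rewrite addrC lerBlDr.
Qed.

Section real_functionals.
Context {R : realType} {Y : normedModType R[i]}.

Lemma dual_of_bounded (f : {linear Y -> R[i]^o}) (M : R[i]) :
  (forall y, `|f y| <= M * `|y|) -> exists u : dual Y, u = f :> (Y -> R[i]^o).
Proof.
move=> fM; have fd : (f : Y -> R[i]^o) \in @dual_pred _ Y.
  apply/asboolP; split; first exact: linearP.
  apply/linear_bounded_continuous/linear_boundedP.
  exists `|M|; split; first exact: normr_real.
  move=> r Mr y; apply: le_trans (fM y) _; have [->|y0] := eqVneq y 0.
    by rewrite normr0 !mulr0.
  have Mreal : M \is Num.real.
    rewrite -(mulfK _ M : M * `|y| / `|y| = M) ?normr_eq0 // realM ?realV ?normr_real //.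
    by apply: ger0_real; apply: le_trans (fM y).
  by rewrite ler_wpM2r // (le_trans (real_ler_norm Mreal)) // ltW.
by exists (Dual fd).
Qed.

(** The complex functional with real part [l] is [l y - i l (i y)]. Its modulus is at most twice the
    bound of [l]. *)
Lemma real_functional_dual (l : Y -> R) (M : R) : real_linear l ->
  (forall y, l y <= M * complex.Re `|y|) ->
  exists u : dual Y, forall y, complex.Re (u y) = l y.
Proof.
move=> rl lM; pose f (y : Y) : R[i]^o := (l y)%:C - 'i%C * (l ('i%C *: y))%:C.
have fl : linear f.
  move=> a u v; have lZ (b : R[i]) y :
      l (b *: y) = complex.Re b * l y + complex.Im b * l ('i%C *: y).
    rewrite -rl.2 -rl.2 -rl.1 scalerA -scalerDl; congr (l (_ *: _)).
    by rewrite [LHS]complexE mulrC.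
  rewrite /f scalerDr !rl.1 scalerA (lZ a u) (lZ ('i * a) u) /GRing.scale /=.
  case: a => a b; apply/eqP; rewrite eq_complex /=; simpc => /=.
  by apply/eqP; ring.
pose F : {linear Y -> R[i]^o} :=
  HB.pack f (GRing.isLinear.Build R[i] Y R[i]^o *:%R f fl).
have lM' y : `|l y| <= M * complex.Re `|y|.
  rewrite ler_norml lM andbT lerNl -(real_linearN rl) -(normrN y).
  exact: lM.
have [y|u uF] := @dual_of_bounded F (M + M)%:C.
  rewrite [leRHS](_ : _ = (M * complex.Re `|y|)%:C + (M * complex.Re `|y|)%:C); last first.
    by rewrite -rmorphD /= -mulrDl rmorphM /= -ReK.
  rewrite /F /= /f; apply: le_trans (ler_normB _ _) _.
  rewrite normrM complexiE normCi mul1r !norm_real_complex lerD // lecR //.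
  by have := lM' ('i *: y); rewrite normrZ normCi mul1r.
exists u => y; rewrite uF /= /f; simpc => /=.
by rewrite ?subr0.
Qed.

End real_functionals.

Lemma norm_sublinear {R : realType} {V : normedModType R[i]} (M : R) :
  0 <= M -> sublinear (fun v : V => M * complex.Re `|v|).
Proof.
move=> M0; split=> [x y|t x t0].
  rewrite -mulrDr ler_wpM2l // -lecR rmorphD /= -!ReK //.
  exact: ler_normD.
rewrite normrZ gtr0_norm ?(ltcR 0) //=.
by case: `|x| => a b; simpc => /=; rewrite mulrCA.
Qed.

(** The [S i v] tend to 0 only weakly, so their norms cannot be used directly. By induction on [s],
    [sublinear_split] replaces one term [M * |S i v|] by a functional of [S i v], the real part of
    an element of the dual, which does tend to 0. Each step spends half of the remaining [d]. *)
Lemma real_linear_le_weak_null {R : realType} {V : lmodType R[i]}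
    {Y : normedModType R[i]} {I : eqType} (F : set_system V) {FF : Filter F}
    (S : I -> {linear V -> Y}) (s : seq I) (p lam : V -> R) (M : R) :
  0 <= M -> sublinear p -> real_linear lam ->
  (forall v, lam v <= p v + \sum_(i <- s) M * complex.Re `|S i v|) ->
  (forall i (u : dual Y), (fun v => u (S i v)) @ F --> (0 : R[i]^o)) ->
  forall d : R, 0 < d -> \forall v \near F, lam v <= p v + d.
Proof.
move=> M0 sp rl lp S0; elim: s lam rl lp => [|i s IH] lam rl lp d d0.
  apply: nearW => v; apply: le_trans (lp v) _.
  by rewrite big_nil addr0 lerDl ltW.
have sS (j : I) : sublinear (fun v => M * complex.Re `|S j v|).
  have [h1 h2] := @norm_sublinear _ Y _ M0; split=> [x y|t x t0].
    by rewrite linearD; exact: h1.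
  by rewrite linearZ; exact: h2.
have ssum : sublinear (fun v => p v + \sum_(j <- s) M * complex.Re `|S j v|).
  apply: (sublinearD sp); elim: s {IH lp} => [|j s IHs].
    by split=> [x y|t x _]; rewrite !big_nil ?addr0 ?mulr0.
  have [h1 h2] := sublinearD (sS j) IHs.
  by split=> [x y|t x t0]; rewrite !big_cons; [exact: h1|exact: h2].
have [v|l [rll lq] ll] := @sublinear_split _ _ _ (S i) _ lam _ ssum (norm_sublinear M0) rl.
  by apply: le_trans (lp v) _; rewrite big_cons addrA addrAC.
have [u ul] := real_functional_dual rll lq.
have rl' : real_linear (fun v => lam v - l (S i v)).
  split=> [x y|t x]; first by rewrite rl.1 linearD rll.1 opprD addrACA.
  by rewrite rl.2 linearZ /= rll.2 mulrBr.
have d20 : 0 < d / 2 by rewrite divr_gt0.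
have := IH _ rl' _ _ d20 => h1.
have {}h1 : \forall v \near F, lam v - l (S i v) <= p v + d / 2.
  by apply: h1 => v; rewrite lerBlDr.
have dC : 0 < (d / 2)%:C :> R[i] by rewrite (ltcR 0).
have /cvgrPdist_le /(_ _ dC) h2 := S0 i u.
move: h1 h2; apply: filterS2 => v h1; rewrite sub0r normrN => h2.
rewrite [d]splitr addrA -lerBlDr; apply: le_trans h1; rewrite lerB //.
rewrite -ul (le_trans (ler_norm _)) // -lecR.
exact: le_trans (Re_le_norm _) h2.
Qed.

(** * Weak topology and operators *)

Section weak_topology.
Context {R : realType} {V : normedModType R[i]}.

Lemma weak_cvgP (F : set_system V) (v : V) : Filter F ->
  (F --> (v : weak V)) <->
  (forall u : dual V, u @ F --> (u v : R[i]^o)).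
Proof.
move=> FF; pose ev : V -> {ptws dual V -> R[i]^o} := fun v u => u v.
have evP : (forall u : dual V, u @ F --> (u v : R[i]^o)) <->
    (ev @ F --> ev v).
  by split=> [h|/pointwise_cvgP h]; [apply/pointwise_cvgP|exact: h].
apply: (iff_trans _ (iff_sym evP)); split=> [Fv|Fv].
  have /= := @initial_continuous _ _ ev v.
  by apply: cvg_trans; exact: cvg_app.
move=> A; rewrite nbhsE /= => -[B [[C oC <-] /= Cv] BA].
apply: filterS BA _; apply: Fv.
by rewrite nbhsE; exists C.
Qed.

(** Compact sets must be closed in the weak topology to witness precompactness. For [Y] and for
    WE(Y) the separation by functionals is derived from [W]. *)
Lemma weak_hausdorff :
  (forall v v' : V, (forall u : dual V, u v = u v') -> v = v') ->
  hausdorff_space (weak V).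
Proof.
move=> sep p q pq; apply: sep => u; apply: (@norm_hausdorff _ R[i]^o) => A B pA qB.
have cu (v : weak V) : (u : weak V -> R[i]^o) @ v --> (u v : R[i]^o).
  exact: (weak_cvgP _ (@nbhs_filter (weak V) v)).1 (@cvg_id _ (nbhs v)) u.
have [v [/= vA vB]] := pq _ _ (cu p _ pA) (cu q _ qB).
by exists (u v).
Qed.

End weak_topology.

Section operator_ideal.
Context {R : realType} {U V Y : normedModType R[i]}.

Lemma bounded_operatorP (A : {linear U -> V}) : bounded_operator A ->
  exists m : nat, forall u, `|A u| <= m%:R * `|u|.
Proof.
move=> [M AM]; have [M0|M0] := boolP (0 <= M).
  have [m Mm] := archiC M0; exists m => u.
  by apply: le_trans (AM u) _; rewrite ler_wpM2r.
(* A nonzero [u] would force [0 <= M], so here the domain is zero. *)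
exists 0%N => u; rewrite mul0r; have [->|u0] := eqVneq u 0.
  by rewrite linear0 normr0.
exfalso; move/negP: M0; apply; rewrite -(pmulr_lge0 _ (_ : 0 < `|u|)).
  exact: le_trans (AM u).
by rewrite normr_gt0.
Qed.

Lemma bounded_continuous (A : {linear U -> V}) :
  bounded_operator A -> continuous A.
Proof.
move=> /bounded_operatorP[m Mm].
apply/linear_bounded_continuous/linear_boundedP.
exists m%:R; split; first exact: realn.
by move=> r mr u; rewrite (le_trans (Mm u)) // ler_wpM2r // ltW.
Qed.

Lemma weak_continuous (A : {linear U -> V}) :
  bounded_operator A -> continuous (A : weak U -> weak V).
Proof.
move=> /bounded_continuous cA v.
apply: (weak_cvgP _ (fmap_filter _ (@nbhs_filter (weak U) v))).2 => u.
have lu : linear (u \o A : U -> R[i]^o).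
  by move=> a x y; rewrite /= linearP dual_lin.
have cu : continuous (u \o A : U -> R[i]^o).
  move=> x; apply: continuous_comp; first exact: cA.
  by have /asboolP[_] := valP u; exact.
have fd : (u \o A : U -> R[i]^o) \in @dual_pred _ U by apply/asboolP.
exact: (weak_cvgP _ (@nbhs_filter (weak U) v)).1 (@cvg_id _ (nbhs v)) (Dual fd).
Qed.

End operator_ideal.

Section factorization.
Context {R : realType} {U V Y : normedModType R[i]}.
Variables (J : {linear Y -> U}) (T : {linear U -> V}) (A : {linear V -> Y}).
Hypotheses (bJ : bounded_operator J) (bA : bounded_operator A).
Hypothesis ATJ : forall y, A (T (J y)) = y.

(** Dividing [J] by [m + 1] sends the unit ball of [Y] into that of [U]; multiplying [A] by [m + 1]
    compensates. The successor keeps the divisor nonzero. *)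
Let ball_subset : exists2 B : {linear V -> Y}, bounded_operator B &
  cunit_ball Y `<=` B @` (T @` cunit_ball U).
Proof.
have [m Jm] := bounded_operatorP bJ.
pose B : {linear V -> Y} := m.+1%:R \*: A.
have [N AN] := bA; exists B.
  exists (m.+1%:R * N) => v; rewrite /B /= normrZ normr_nat -mulrA.
  by rewrite ler_wpM2l.
move=> y y1; exists (T (m.+1%:R^-1 *: J y)); last first.
  rewrite /B /= !linearZ /= ATJ scalerA mulVf ?pnatr_eq0 //.
  by rewrite scale1r.
exists (m.+1%:R^-1 *: J y) => //.
rewrite /cunit_ball /= normrZ normfV normr_nat ler_pdivrMl ?ltr0n // mulr1.
apply: le_trans (Jm y) _; apply: (@le_trans _ _ m%:R); last by rewrite ler_nat.
by rewrite -[leRHS]mulr1 ler_wpM2l.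
Qed.

Lemma compact_factor : compact_operator T ->
  compact_operator (idfun : {linear Y -> Y}).
Proof.
have [B bB sB] := ball_subset => -[K TK [cK _]].
rewrite /compact_operator image_id; exists (B @` K).
  by apply: subset_trans sB _; exact: image_subset.
have cBK : compact (B @` K).
  by apply: continuous_compact cK; exact/continuous_subspaceT/bounded_continuous.
by split=> //; apply: compact_closed cBK; exact: norm_hausdorff.
Qed.

Lemma weakly_compact_factor :
  (forall v v' : Y, (forall u : dual Y, u v = u v') -> v = v') ->
  weakly_compact_operator T ->
  weakly_compact_operator (idfun : {linear Y -> Y}).
Proof.
move=> sep; have [B bB sB] := ball_subset => -[K TK [cK _]].
rewrite /weakly_compact_operator image_id; exists (B @` K).
  by apply: subset_trans sB _; exact: image_subset.
have cBK : compact (B @` K : set (weak Y)).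
  apply: (@continuous_compact (weak V) (weak Y)) cK.
  exact/continuous_subspaceT/weak_continuous.
by split=> //; apply: compact_closed cBK; exact: weak_hausdorff.
Qed.

End factorization.

Lemma compact_operator_bounded {R : realType} {U V : normedModType R[i]}
    (T : {linear U -> V}) : compact_operator T -> bounded_operator T.
Proof.
move=> [K TK [cK _]].
(* Each point of [K] has a neighbourhood on which the norm is bounded by all large [n]; compactness
   gives one [n] for all of [K]. *)
have /compact_near_coveringP/(_ _ \oo (fun n v => `|v| <= n%:R) _) := cK.
case=> [v _|n _ nK].
  have [m vm] := archiC (normr_ge0 v).
  exists ([set u | `|v - u| <= 1], [set n | (m.+1 <= n)%N]).
    split; last by exists m.+1.
      by have /cvgrPdist_le/(_ _ ltr01) := @cvg_id _ (nbhs v).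
  move=> [u n] [/= vu mn]; rewrite -(subKr v u) (le_trans (ler_normB _ _)) //.
  apply: (@le_trans _ _ m.+1%:R); last by rewrite ler_nat.
  by rewrite -natr1 lerD.
exists n%:R => u; have [->|u0] := eqVneq u 0.
  by rewrite linear0 !normr0 mulr0.
have nu : 0 < `|u| by rewrite normr_gt0.
rewrite -ler_pdivrMr // mulrC.
rewrite (_ : _ * _ = `|T (`|u|^-1 *: u)|); last first.
  by rewrite linearZ normrZ normfV normr_id.
apply: nK; first exact: leqnn.
apply: TK; exists (`|u|^-1 *: u) => //.
by rewrite /cunit_ball /= normrZ normfV normr_id mulVf // gt_eqF.
Qed.

(** * Spaces of holomorphic functions *)

Lemma set_type_cvg {T : topologicalType} (A : set T) (F : set_system A) (x : A) :
  Filter F -> (\val @ F --> \val x) -> F --> x.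
Proof.
move=> FF Fx B; rewrite nbhsE /= => -[D [[C oC <-] /= Cx] DB].
by apply: filterS DB _; apply: Fx; rewrite nbhsE; exists C.
Qed.

(** An ultrafilter on this set that does not converge to [x] contains the complement of a
    neighbourhood of [x]. It then lives on finitely many terms, which form a compact set. *)
Lemma cvg_sequence_compact {T : topologicalType} (u : nat -> T) (x : T) :
  u @ \oo --> x -> compact (x |` range u).
Proof.
move=> ux; rewrite compact_ultra => F UF Fxu.
have [Fx|Fx] := pselect (F --> x); first by exists x; split=> //; left.
have /existsNP[U /not_implyP[xU FU]] : ~ (nbhs x `<=` F) by [].
have FCU : F (~` U) by have [//|] := in_ultra_setVsetC U UF.
have [N _ NU] := ux _ xU.
have Fu : F (u @` [set` iota 0 N]).
  apply: filterS (filterI Fxu FCU) => y [[->|[n _ <-]] nU].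
    by exfalso; apply: nU; exact: nbhs_singleton.
  exists n => //=; rewrite mem_iota add0n leq0n /= ltnNge.
  by apply/negP => Nn; apply: nU; exact: NU.
have : compact (u @` [set` iota 0 N]).
  exact/finite_compact/finite_image/finite_seq.
rewrite compact_ultra => /(_ F UF Fu) [y [[n _ <-] Fy]].
by exists (u n); split=> //; right; exists n.
Qed.

Section holomorphic_continuous.
Context {R : realType} {X Z : normedModType R[i]}.

Lemma holomorphic_continuous (f : oball X -> Z) : holomorphic f -> continuous f.
Proof.
move=> hf x; have /differentiable_continuous := hf x.
have fE (y : oball X) : 'valL_0 f (\val y) = f y.
  by have /(congr1 (fun h : oball X -> Z => h y)) := valLK 0 f.
move=> cf.
have -> : f = 'valL_0 f \o \val by apply/funext => y; rewrite -fE.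
have cv : {for x, continuous (\val : oball X -> X)} by exact: initial_continuous.
exact: (@continuous_comp _ _ _ (\val : oball X -> X) ('valL_0 f) x cv cf).
Qed.

Lemma continuous_bounded_near (f : oball X -> Z) (x : oball X) :
  continuous f -> \forall y \near x, `|f y| <= `|f x| + 1.
Proof.
move=> cf; have /cvgrPdist_le/(_ _ ltr01) := cf x.
apply: filterS => y fxy; rewrite -(subKr (f x) (f y)).
by rewrite (le_trans (ler_normB _ _)) // lerD.
Qed.

End holomorphic_continuous.

Lemma holomorphic_self_map_continuous {R : realType} {X : normedModType R[i]}
    (phi : oball X -> oball X) :
  holomorphic (fun x => \val (phi x) : X) -> continuous phi.
Proof.
move=> /holomorphic_continuous cphi x.
by apply: set_type_cvg; [exact: (fmap_filter _ (@nbhs_filter (oball X) x))|exact: cphi].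
Qed.

Section holo_space_theory.
Context {R : realType} {X : normedModType R[i]} (E : holo_space X).
Hypothesis compE : unit_ball_co_compact E.

Lemma compact_open_cvg_eval (F : set_system {compact-open, oball X -> R[i]^o})
    (g : {compact-open, oball X -> R[i]^o}) (x : oball X) : Filter F ->
  F --> g -> (fun h => h x) @ F --> (g x : R[i]^o).
Proof.
move=> FF /compact_open_cvgP Fg A; rewrite nbhsE => -[D [oD Dgx] DA].
have : F [set h : {compact-open, oball X -> R[i]^o} | h @` [set x] `<=` D].
  by apply: Fg => //; [exact: compact_set1 | move=> _ [_ -> <-] ].
by apply: (filterS (F := F)) => h hD; apply: DA; apply: hD; exists x.
Qed.

Lemma holo_space_continuous (e : E) : continuous (hs_fun E e).
Proof. exact/holomorphic_continuous/hs_holo. Qed.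

(* The members of the unit ball are bounded on the compact set consisting of a
   convergent sequence and its limit, uniformly since the ball is compact. *)
Lemma eval_locally_bounded (x : oball X) : exists2 M : R[i], 0 <= M &
  \forall y \near x, forall e : E, `|hs_fun E e y| <= M * `|e|.
Proof.
suff [M M0 h] : exists2 M : R[i], 0 <= M &
    \forall y \near x, forall e : E, `|e| <= 1 -> `|hs_fun E e y| <= M.
  exists M => //; apply: filterS h => y h e.
  have [->|e0] := eqVneq e 0.
    by rewrite linear0 !normr0 mulr0.
  have ne : 0 < `|e| by rewrite normr_gt0.
  rewrite -ler_pdivrMr // mulrC.
  have := h (`|e|^-1 *: e); rewrite linearZ /= normrM normfV normr_id.
  by apply; rewrite normrZ normfV normr_id mulVf // gt_eqF.
apply: contrapT => nbd.
(* If no bound holds near [x], then for each [n] some member of the unit ball exceeds [n] at a point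
   closer to [x] than [1 / (n + 1)]. *)
have bad (n : nat) : exists p : oball X * E,
    [/\ `|\val x - \val p.1| < n.+1%:R^-1, `|p.2| <= 1 &
        n%:R < `|hs_fun E p.2 p.1| ].
  apply: contrapT => nex; apply: nbd; exists n%:R => //.
  have : \forall y \near x, ball (\val x) (n.+1%:R^-1 : R[i]) (\val y).
    apply: (@initial_continuous _ _ (\val : oball X -> X) x).
    by apply: nbhsx_ballx; rewrite invr_gt0 ltr0n.
  apply: filterS => y xy e e1; rewrite real_leNgt ?normr_real ?realn //.
  apply/negP => ney; apply: nex; exists (y, e); split=> //=.
  by move: xy; rewrite -ball_normE.
have [p pP] := choice bad.
have px : (fun n => (p n).1) @ \oo --> x.
  apply: set_type_cvg; apply/cvgrPdist_lt => /= d d0.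
  have [m md] := archiC (ltW (divr_gt0 ltr01 d0)).
  exists m => // n /= mn; have [pn _ _] := pP n.
  apply: lt_trans pn _; rewrite invf_plt ?posrE ?ltr0n // -div1r.
  by rewrite (le_lt_trans md) // ltr_nat ltnS.
have cK := cvg_sequence_compact px.
set K := _ |` _ in cK.
(* Functions close to a given [e] on [K] are bounded there by some [m], so their value at [p n] is
   at most [n] once [n >= m]. Compactness gives an [n] valid on the whole unit ball, against the
   choice of [p n]. *)
have /compact_near_coveringP := compE.
move=> /(_ _ \oo (fun n (h : {compact-open, oball X -> R[i]^o}) =>
  `|h (p n).1| <= n%:R) _).
case=> [_ [e /= e1 <-]|n _ /(_ n (leqnn n)) nK]; last first.
  have [_ p1 pn] := pP n.
  have /nK /= : (hs_fun E @` cunit_ball E) (hs_fun E (p n).2).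
    by exists (p n).2.
  by rewrite real_leNgt ?normr_real ?realn // pn.
have [m mK] : exists m : nat, forall y, K y -> `|hs_fun E e y| < m%:R.
  have : compact (hs_fun E e @` K).
    by apply: continuous_compact => //; exact/continuous_subspaceT/holo_space_continuous.
  move=> /compact_near_coveringP/(_ _ \oo (fun n v => `|v| < n%:R) _).
  case=> [v _|n _ /(_ n (leqnn n)) nK].
    have [m vm] := archiC (normr_ge0 v).
    exists ([set u : R[i]^o | `|v - u| < 1], [set n | (m.+1 <= n)%N]).
      split; last by exists m.+1.
      by have /cvgrPdist_lt/(_ _ ltr01) := @cvg_id _ (nbhs v).
    move=> [u n] [/= vu mn]; rewrite -(subKr v u) (le_lt_trans (ler_normB _ _)) //.
    apply: (@lt_le_trans _ _ m.+1%:R); last by rewrite ler_nat.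
    by rewrite -natr1 ler_ltD.
  by exists n => y Ky; apply: nK; exists y.
pose O := ball (0 : R[i]^o) (m%:R : R[i]).
have OE z : O z = (`|z| < m%:R) :> Prop by rewrite /O -ball_normE /= sub0r normrN.
have oO : open O by exact: ball_open.
exists ([set h : {compact-open, oball X -> R[i]^o} | h @` K `<=` O], [set n | (m <= n)%N]).
  split; last by exists m.
  apply: open_nbhs_nbhs; split; first exact: compact_open_open.
  by move=> _ [y Ky <-]; rewrite OE; exact: mK.
move=> [h n] [/= hK mn]; apply: ltW; apply: (@lt_le_trans _ _ m%:R); last by rewrite ler_nat.
by rewrite -OE; apply: hK; exists (p n).1 => //; right; exists n.
Qed.

Lemma eval_bounded (x : oball X) : exists2 M : R[i], 0 <= M &
  forall e : E, `|hs_fun E e x| <= M * `|e|.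
Proof.
by have [M M0 /nbhs_singleton h] := eval_locally_bounded x; exists M.
Qed.

(** By compactness a finer filter converges to a member [k] of the unit ball in the compact-open
    topology, hence pointwise, and pointwise limits are unique. *)
Lemma unit_ball_pointwise_closed {T : Type} (F : set_system T)
    {FF : ProperFilter F} (e : T -> E) (h : oball X -> R[i]^o) :
  (\forall t \near F, `|e t| <= 1) ->
  (forall x, (fun t => hs_fun E (e t) x) @ F --> h x) ->
  exists2 k : E, `|k| <= 1 & hs_fun E k = h.
Proof.
move=> e1 eh.
pose G : set_system {compact-open, oball X -> R[i]^o} :=
  (fun t => hs_fun E (e t)) @ F.
have GG : ProperFilter G by exact: fmap_proper_filter.
have [|_ [[k /= k1 <-]]] := compE GG.
  by apply: filterS e1 => t et; exists (e t).
rewrite cluster_cvgE => -[G' GG' [G'k GG'le]].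
exists k => //; apply/funext => x.
have hk : (fun h => h x) @ G' --> (hs_fun E k x : R[i]^o).
  exact: compact_open_cvg_eval.
have hh : (fun h => h x) @ G' --> (h x : R[i]^o).
  by apply: cvg_trans (eh x) => A; exact: GG'le.
exact: (norm_cvg_unique hk hh).
Qed.

End holo_space_theory.

(** * Almost norming subspaces and the spaces WE(Y) *)

Section qnorm_theory.
Context {R : realType} {Y : normedModType R[i]} (W : submodClosed (dual Y)).

Lemma dual_le (w : dual Y) (y : Y) : `|w y| <= `|w| * `|y|.
Proof.
have [->|y0] := eqVneq y 0; first by rewrite dual0 !normr0 mulr0.
have ny : 0 < `|y| by rewrite normr_gt0.
rewrite -ler_pdivrMr // mulrC.
have <- : `|w (`|y|^-1 *: y)| = `|y|^-1 * `|w y|.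
  by rewrite dualZ normrM normfV normr_id.
by apply: dual_norm_ub; rewrite normrZ normfV normr_id mulVf // gt_eqF.
Qed.

Lemma almost_norming_bound : almost_norming W ->
  exists2 c : R[i], 0 < c & forall (y : Y) (M : R[i]), 0 <= M ->
    (forall w, w \in W -> `|w| <= 1 -> `|w y| <= M) -> `|y| <= c * M.
Proof.
move=> [c c0 [d _ cd]]; exists c^-1; first by rewrite invr_gt0.
move=> y M M0 wM; have /andP[cy _] := cd y.
rewrite ler_pdivlMl //; apply: le_trans cy _.
by apply: csup_le => // _ [w [Ww w1] <-]; exact: wM.
Qed.

End qnorm_theory.

Lemma dual_normalize {R : realType} {Y : normedModType R[i]} (w : dual Y) :
  w != 0 -> `| `|w|^-1 *: w| <= 1 /\ w = `|w| *: (`|w|^-1 *: w).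
Proof.
move=> w0; have nw : `|w| != 0 by rewrite normr_eq0.
by rewrite normrZ normfV normr_id mulVf // scalerA mulfV // scale1r.
Qed.

Section WE_theory.
Context {R : realType} {X Y : normedModType R[i]} {W : submodClosed (dual Y)}.
Variable sepW : separating W.

Section WE_basics.
Variable E : holo_space X.
Implicit Type f : WE_space E sepW.

Lemma WE_comp f (w : dual Y) : w \in W ->
  exists2 e : E, hs_fun E e = w \o f & `|e| <= `|w| * `|f|.
Proof.
move=> Ww; have /asboolP[_ Wf _] := valP f.
have [e ew] := Wf w Ww; exists e => //.
have [w0|w0] := eqVneq w 0.
  suff -> : e = 0 by rewrite normr0 mulr_ge0.
  apply: (hs_inj E); rewrite linear0 ew w0; apply/funext => x //=.
have [w1 wE] := dual_normalize w0.
have nw : 0 < `|w| by rewrite normr_gt0.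
rewrite -ler_pdivrMl //.
have -> : `|w|^-1 * `|e| = `| `|w|^-1 *: e| by rewrite normrZ normfV normr_id.
apply: WE_fnorm_ub; first exact: (valP f).
exists (`|w|^-1 *: w), (`|w|^-1 *: e); split=> //; first exact: rpredZ.
by rewrite linearZ /= ew.
Qed.

Lemma WE_norm_le f (M : R[i]) : 0 <= M ->
  (forall w e, w \in W -> `|w| <= 1 -> hs_fun E e = w \o f -> `|e| <= M) ->
  `|f| <= M.
Proof. by move=> M0 h; apply: csup_le => // _ [w [e [Ww w1 ew ->]]]; exact: h ew. Qed.

(** It is enough to test functionals [w] of norm at most 1: the others follow by scaling, and the
    common bound [M] gives both the finiteness of the norm and its estimate. *)
Lemma WE_intro (f : oball X -> Y) (M : R[i]) : 0 <= M ->
  (forall x : oball X, bounded_near f (nbhs x)) ->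
  (forall w, w \in W -> `|w| <= 1 ->
    exists2 e : E, hs_fun E e = w \o f & `|e| <= M) ->
  exists2 g : WE_space E sepW, WE_val g = f & `|g| <= M.
Proof.
move=> M0 bf h.
have fE : f \in WE_pred W E.
  apply/asboolP; split=> //.
    move=> w Ww; have [->|w0] := eqVneq w 0.
      by exists 0; rewrite linear0; apply/funext.
    have [w1 wE] := dual_normalize w0.
    have [|//|e ew _] := h (`|w|^-1 *: w); first exact: rpredZ.
    exists (`|w| *: e); rewrite linearZ /= ew.
    by apply/funext => x; rewrite [in RHS]wE.
  exists M => _ [w [e [Ww w1 ew ->]]].
  have [e' e'w e'M] := h w Ww w1.
  by have /(hs_inj E) -> : hs_fun E e = hs_fun E e' by rewrite ew.
exists (WESpace sepW fE) => //; apply: WE_norm_le => // w e Ww w1 ew.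
have [e' e'w e'M] := h w Ww w1.
by have /(hs_inj E) -> : hs_fun E e = hs_fun E e' by rewrite ew.
Qed.

End WE_basics.

Section WE_almost_norming.
Hypothesis normW : almost_norming W.
Variable E : holo_space X.
Hypothesis compE : unit_ball_co_compact E.

Lemma WE_eval_locally_bounded (x : oball X) : exists2 M : R[i], 0 <= M &
  \forall y \near x, forall f : WE_space E sepW, `|f y| <= M * `|f|.
Proof.
have [c c0 cP] := almost_norming_bound normW.
have [M M0 xM] := eval_locally_bounded compE x.
exists (c * M); first by rewrite mulr_ge0 // ltW.
apply: filterS xM => y yM f; rewrite -mulrA; apply: cP.
  by rewrite mulr_ge0.
move=> w Ww w1; have [e ew ewf] := WE_comp f Ww.
have -> : w (f y) = hs_fun E e y by rewrite ew.
apply: le_trans (yM e) _; rewrite ler_wpM2l //.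
by apply: le_trans ewf _; rewrite -[leRHS]mul1r ler_wpM2r.
Qed.

Lemma WE_eval_bounded (x : oball X) : exists2 M : R[i], 0 <= M &
  forall f : WE_space E sepW, `|f x| <= M * `|f|.
Proof.
by have [M M0 /nbhs_singleton h] := WE_eval_locally_bounded x; exists M.
Qed.

(** Each [w \o g] is a pointwise limit of members of the unit ball of [E], so it lies there.
    Convergence is only tested by [W], so that norm limits and weak limits are both covered. *)
Lemma WE_unit_ball_pointwise_closed {T : Type} (F : set_system T)
    {FF : ProperFilter F} (f : T -> WE_space E sepW) (g : oball X -> Y) :
  (\forall t \near F, `|f t| <= 1) ->
  (forall w x, w \in W -> (fun t => w (f t x)) @ F --> (w (g x) : R[i]^o)) ->
  exists2 g' : WE_space E sepW, WE_val g' = g & `|g'| <= 1.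
Proof.
move=> f1 fg; have [c c0 cP] := almost_norming_bound normW.
apply: WE_intro => [//|x|w Ww w1]; last first.
  have /choice[e eP] : forall t, exists e : E, hs_fun E e = w \o f t /\ `|e| <= `|w| * `|f t|.
    by move=> t; have [e ? ?] := WE_comp (f t) Ww; exists e.
  have [|x|k k1 kE] := @unit_ball_pointwise_closed _ _ _ compE _ F _ e (w \o g).
  - apply: filterS f1 => t t1; have [_ et] := eP t.
    by apply: le_trans et _; rewrite -[leRHS]mulr1 ler_pM.
  - under eq_fun do rewrite (eP _).1.
    exact: fg.
  by exists k.
(* Local boundedness of [g]: evaluations near [x] are uniformly bounded on the unit ball, and the
   bound on each [w (f t y)] passes to the limit. *)
apply/ex_bound; have [M M0 xM] := WE_eval_locally_bounded x.
exists (c * M); apply: filterS xM => y yM /=; apply: cP => // w Ww w1.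
apply: cvg_norm_le (fg w y Ww) _.
apply: filterS f1 => t t1.
apply: le_trans (dual_le _ _) _; apply: le_trans (ler_wpM2r _ w1) _ => //.
rewrite mul1r; apply: le_trans (yM _) _.
by rewrite -[leRHS]mulr1 ler_wpM2l.
Qed.

End WE_almost_norming.
End WE_theory.

(** * Weighted composition operators *)

Section induced_operators.
Context {R : realType}.

Lemma induced_linear {D : Type} {Z : lmodType R[i]}
    (op : (D -> Z) -> (D -> Z)) (F1 F2 : function_space D Z) :
  (forall (a : R[i]) f g, op (a *: f + g) = a *: op f + op g) ->
  (forall f : F1, exists h : F2, fs_fun F2 h = op (fs_fun F1 f)) ->
  exists T : {linear F1 -> F2}, induces op T.
Proof.
move=> op_lin /choice[T TE].
have lT : linear T.
  by move=> a f g; apply: (@fs_inj _ _ _ F2); rewrite linearP !TE linearP op_lin.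
pose L : {linear F1 -> F2} := HB.pack T (GRing.isLinear.Build R[i] F1 F2 *:%R T lT).
by exists L => f; exact: TE.
Qed.

Context {X : normedModType R[i]}.
Variables (psi : oball X -> R[i]^o) (phi : oball X -> oball X).

Lemma wcomp_linear {Z : normedModType R[i]} (a : R[i]) (f g : oball X -> Z) :
  wcomp psi phi (a *: f + g) = a *: wcomp psi phi f + wcomp psi phi g.
Proof.
apply/funext => x; rewrite /wcomp !fctE scalerDr !scalerA.
by rewrite [_ * a]mulrC.
Qed.

Lemma wcomp_dual {Y : normedModType R[i]} (w : dual Y) (f : oball X -> Y) :
  w \o wcomp psi phi f = wcomp psi phi (w \o f : _ -> R[i]^o).
Proof.
by apply/funext => x; exact: dualZ.
Qed.

Hypotheses (psi_cont : continuous psi) (phi_cont : continuous phi).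
Context {Y : normedModType R[i]} {W : submodClosed (dual Y)}.
Variables (sepW : separating W) (E1 E2 : holo_space X).

Lemma wcomp_bounded_near (f : oball X -> Y) (x : oball X) :
  bounded_near f (nbhs (phi x)) -> bounded_near (wcomp psi phi f) (nbhs x).
Proof.
move=> /ex_bound[M fM]; apply/ex_bound; exists ((`|psi x| + 1) * M).
have h2 : \forall y \near x, `|f (phi y)| <= M by exact: phi_cont fM.
move: (continuous_bounded_near x psi_cont) h2; apply: filterS2 => y h1 h2.
by rewrite /= /wcomp normrZ ler_pM.
Qed.

Lemma bounded_between_WE :
  bounded_between (wcomp psi phi) E1 E2 ->
  bounded_between (wcomp psi phi) (WE sepW E1) (WE sepW E2).
Proof.
move=> [T Top /bounded_operatorP[m Tm]].
have h (f : WE_space E1 sepW) : exists2 g : WE_space E2 sepW,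
    WE_val g = wcomp psi phi (WE_val f) & `|g| <= m%:R * `|f|.
  apply: WE_intro => [|x|w Ww w1]; first by rewrite mulr_ge0.
    by apply: wcomp_bounded_near; have /asboolP[] := valP f.
  have [e ew ef] := WE_comp f Ww; exists (T e).
    by rewrite (Top e) /= ew wcomp_dual.
  apply: le_trans (Tm e) _; rewrite ler_wpM2l //; apply: le_trans ef _.
  by rewrite -[leRHS]mul1r ler_wpM2r.
have [f|T' T'op] := @induced_linear _ _ _ (WE sepW E1) (WE sepW E2) (@wcomp_linear Y).
  by have [g gE _] := h f; exists g.
exists T' => //; exists m%:R => f; have [g gE gf] := h f.
by have -> : T' f = g by apply: val_inj; rewrite [LHS](T'op f) /= gE.
Qed.

(** Composing with [w] gives [w y *: e]. For [e = 1] these are the constant functions. *)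
Lemma WE_tensor (E : holo_space X) (e : E) (y : Y) :
  exists2 f : WE_space E sepW,
    WE_val f = (fun x => hs_fun E e x *: y) & `|f| <= `|e| * `|y|.
Proof.
apply: WE_intro => [|x|w Ww w1]; first by rewrite mulr_ge0.
  apply/ex_bound; exists ((`|hs_fun E e x| + 1) * `|y|).
  have := continuous_bounded_near x (@holo_space_continuous _ _ E e).
  by apply: filterS => z ez; rewrite /= normrZ ler_wpM2r.
exists (w y *: e).
  by apply/funext => x; rewrite linearZ /= dualZ mulrC.
rewrite normrZ mulrC ler_wpM2l // (le_trans (dual_le w y)) //.
by rewrite -[leRHS]mul1r ler_wpM2r.
Qed.

Lemma separating_neq0 (y : Y) : y != 0 -> exists2 w, w \in W & w y != 0.
Proof.
move=> y0; apply: contrapT => nw; move/eqP: y0; apply.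
apply: sepW => w Ww; rewrite dual0; apply/eqP/negPn/negP => wy.
by apply: nw; exists w.
Qed.

(** With [w y != 0], the scalar operator is recovered as [e |-> (w y)^-1 *: (w \o T (e y))], and [M]
    multiplies the norms of these steps. A nonzero [y] is required since for [Y = 0] the
    vector-valued operator is always bounded. *)
Lemma bounded_between_of_WE : (exists y : Y, y != 0) ->
  bounded_between (wcomp psi phi) (WE sepW E1) (WE sepW E2) ->
  bounded_between (wcomp psi phi) E1 E2.
Proof.
move=> [y y0] [T Top /bounded_operatorP[m Tm]].
have [w Ww wy0] := separating_neq0 y0.
pose M := `|(w y)^-1| * (`|w| * (m%:R * `|y|)).
have h (e : E1) : exists2 g : E2,
    hs_fun E2 g = wcomp psi phi (hs_fun E1 e) & `|g| <= M * `|e|.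
  have [f fE fe] := WE_tensor e y.
  have [g gE gf] := WE_comp (T f) Ww.
  exists ((w y)^-1 *: g).
    rewrite linearZ /= gE; have -> : WE_val (T f) = wcomp psi phi (WE_val f).
      exact: (Top f).
    rewrite wcomp_dual fE; apply/funext => x; rewrite /wcomp !fctE /= dualZ.
    by rewrite /GRing.scale /= mulrCA [_ * w y]mulrC mulKf.
  rewrite normrZ /M -!mulrA ler_wpM2l //; apply: le_trans gf _.
  rewrite ler_wpM2l //; apply: le_trans (Tm f) _.
  by rewrite ler_wpM2l // mulrC.
have [e|T' T'op] := @induced_linear _ _ _ E1 E2 (@wcomp_linear R[i]^o).
  by have [g gE _] := h e; exists g.
exists T' => //; exists M => e; have [g gE ge] := h e.
by have -> : T' e = g by apply: (hs_inj E2); rewrite [LHS](T'op e) /= gE.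
Qed.

End induced_operators.

(** * Compactness and weak compactness of the vector-valued operator *)

Lemma fmap_ultra {T U : Type} (f : T -> U) (F : set_system T) :
  UltraFilter F -> UltraFilter (f @ F).
Proof.
move=> FU; split=> [|G GG FG]; first exact: fmap_proper_filter.
apply/seteqP; split=> // A GA.
have [//|FnA] := in_ultra_setVsetC (f @^-1` A) FU.
have : G (A `&` ~` A) by apply: filterI => //; exact: FG.
by rewrite setICr => /filter_not_empty.
Qed.

Lemma image_compact {T : topologicalType} {U : Type} (B : set U) (f : U -> T) :
  (forall F : set_system U, UltraFilter F -> F B ->
    exists2 u, B u & f @ F --> f u) -> compact (f @` B).
Proof.
move=> fB; rewrite compact_ultra => G GU GB.
have [_ [u0 Bu0 _]] := filter_ex GB.
(* Outside the image [s] takes the default value [u0], so that it always has values in [B]. *)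
have /choice[s sP] : forall v, exists u, B u /\ ((f @` B) v -> f u = v).
  move=> v; have [[u Bu <-]|nv] := pselect ((f @` B) v); first by exists u.
  by exists u0.
have sB : (s @ G) B by apply: (filterS (F := G)) GB => v _; case: (sP v).
have [u Bu fu] := fB _ (fmap_ultra s GU) sB.
exists (f u); split; first by exists u.
move=> A /fu GA.
have : G ([set v | A (f (s v))] `&` (f @` B)) by exact: filterI.
apply: (filterS (F := G)) => v [/= + Bv].
by have [_ ->] := sP v.
Qed.

(* Off a ball around [0], the compact image of the unit ball is covered by
   finitely many of the open sets [{e | 1 < n |e x|}]. *)
Lemma compact_operator_estimate {R : realType} {X U : normedModType R[i]}
    (E : holo_space X) (T : {linear U -> E}) :
  unit_ball_co_compact E -> compact_operator T ->
  forall d : R[i], 0 < d -> exists (s : seq (oball X)) (m : nat), forall u,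
    `|T u| <= d * `|u| + \sum_(x <- s) m%:R * `|hs_fun E (T u) x|.
Proof.
move=> compE cT d d0; have [b Tb] := bounded_operatorP (compact_operator_bounded cT).
have [K TK [cK _]] := cT.
suff [s [m h]] : exists (s : seq (oball X)) (m : nat), forall u, `|u| <= 1 ->
    `|T u| <= d + \sum_(x <- s) m%:R * `|hs_fun E (T u) x|.
  exists s, m => u; have [->|u0] := eqVneq u 0.
    rewrite linear0 !normr0 mulr0 add0r.
    by apply: sumr_ge0 => x _; rewrite mulr_ge0.
  have nu : 0 < `|u| by rewrite normr_gt0.
  have := h (`|u|^-1 *: u); rewrite normrZ normfV normr_id mulVf ?gt_eqF //.
  move=> /(_ (lexx _)); rewrite linearZ /= normrZ normfV normr_id ler_pdivrMl //.
  rewrite mulrDr mulrC => /le_trans; apply.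
  rewrite lerD2l mulr_sumr ler_sum // => x _.
  by rewrite linearZ /= normrM normfV normr_id mulrCA mulVKf ?gt_eqF.
pose V (p : oball X * nat) := ~` [set e : E | `|hs_fun E e p.1 *+ p.2| <= 1].
have oV p : open (V p).
  apply: closed_openC.
  pose g (e : E) : R[i]^o := hs_fun E e p.1 *+ p.2.
  have lg : linear g.
    move=> a e f; rewrite /g linearP /= mulrnDl; congr (_ + _).
    by rewrite -scalerMnr.
  pose G : {linear E -> R[i]^o} := HB.pack g (GRing.isLinear.Build R[i] E R[i]^o *:%R g lg).
  have bG : bounded_operator G.
    have [M M0 pM] := eval_bounded compE p.1; exists (p.2%:R * M) => e.
    by rewrite /G /= /g normrMn -mulrA mulr_natl lerMn2r pM orbT.
  have := @closed_norm_le _ R[i]^o 1.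
  by apply: closed_comp => e _; exact: (bounded_continuous bG).
have := compact_closedI cK (open_closedC (ball_open (0 : E) d)).
rewrite compact_cover => /(_ (oball X * nat)%type setT V) [p _|e [_ ed]|D _ DK].
- exact: oV.
- have e0 : e != 0.
    by apply/eqP => e0; apply: ed; rewrite e0; exact: ballxx.
  have [x ex] : exists x, hs_fun E e x != 0.
    apply: contrapT => nx; move/eqP: e0; apply; apply: (hs_inj E).
    rewrite linear0; apply/funext => x; apply/eqP/negPn/negP => ex.
    by apply: nx; exists x.
  have nex : 0 < `|hs_fun E e x| by rewrite normr_gt0.
  have [n nx] := archiC (ltW (divr_gt0 ltr01 nex)).
  exists (x, n.+1) => //; rewrite /V /= normrMn -mulr_natl -ler_pdivlMr // => /le_trans/(_ nx).
  by rewrite ler_nat ltnn.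
(* On [V p] one has [1 < p.2 * |(T u) x|] for [x = p.1], and [|T u| <= b]. The sum of all [p.2],
   times [b], is a single constant that serves for every [p] in [D]. *)
exists [seq p.1 | p <- finmap.enum_fset D], (b * \sum_(p <- finmap.enum_fset D) p.2)%N.
move=> u u1; have TuK : K (T u) by apply: TK; exists u.
have [Tud|Tud] := pselect (ball (0 : E) d (T u)).
  move: Tud; rewrite -ball_normE /= sub0r normrN => /ltW/le_trans; apply.
  by rewrite lerDl; apply: sumr_ge0 => x _; rewrite mulr_ge0.
have [p /= pD /negP] := DK _ (conj TuK Tud).
rewrite -real_ltNge ?normr_real ?real1 // normrMn -[_ *+ p.2]mulr_natl => Vp.
rewrite big_map (big_rem p pD) /= addrCA; apply: ler_wpDr.
  by rewrite addr_ge0 ?(ltW d0) //; apply: sumr_ge0 => q _; rewrite mulr_ge0.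
apply: le_trans (Tb u) _; apply: (@le_trans _ _ (b%:R * 1)); first by rewrite ler_wpM2l.
rewrite natrM -mulrA ler_wpM2l //; apply: le_trans (ltW Vp) _.
by rewrite ler_wpM2r // ler_nat (big_rem p pD) leq_addr.
Qed.

Section compact_composition.
Context {R : realType} {X Y : normedModType R[i]} {W : submodClosed (dual Y)}.
Variables (normW : almost_norming W) (E1 E2 : holo_space X).
Hypotheses (const1 : contains_constants E1).
Hypotheses (compE1 : unit_ball_co_compact E1) (compE2 : unit_ball_co_compact E2).
Variables (psi : oball X -> R[i]^o) (phi : oball X -> oball X).
Let sepW := almost_norming_separating normW.
Local Notation WE1 := (WE_space E1 sepW).
Local Notation WE2 := (WE_space E2 sepW).
Variable T : {linear WE1 -> WE2}.
Hypothesis Top : forall f, WE_val (T f) = wcomp psi phi (WE_val f).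

Lemma separating_dual (y z : Y) : (forall u : dual Y, u y = u z) -> y = z.
Proof. by move=> h; apply: sepW => w _; exact: h. Qed.

Lemma WE_eval_linear (x : oball X) :
  exists S : {linear WE2 -> Y}, forall f, S f = WE_val f x.
Proof.
have lS : linear (fun f : WE2 => WE_val f x) by [].
pose S : {linear WE2 -> Y} := HB.pack (fun f : WE2 => WE_val f x)
  (GRing.isLinear.Build R[i] WE2 Y *:%R _ lS).
by exists S.
Qed.

(** The functionals [f |-> w (f x)], with [w] in [W], are continuous because evaluations are
    bounded, and they separate the functions. *)
Lemma WE_separating_dual (f g : WE2) : (forall u : dual WE2, u f = u g) -> f = g.
Proof.
move=> fg; apply: val_inj; apply/funext => x; apply: sepW => w Ww.
have [S SE] := WE_eval_linear x.
have lwS : linear (fun f : WE2 => w (S f) : R[i]^o).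
  by move=> a k l; rewrite linearP dual_lin.
pose L : {linear WE2 -> R[i]^o} := HB.pack (fun f : WE2 => w (S f) : R[i]^o)
  (GRing.isLinear.Build R[i] WE2 R[i]^o *:%R _ lwS).
have [M M0 xM] := WE_eval_bounded sepW normW compE2 x.
have [k|u uL] := @dual_of_bounded _ _ L (`|w| * M).
  rewrite /L /= SE; apply: le_trans (dual_le _ _) _.
  by rewrite -mulrA ler_wpM2l.
by have := fg u; rewrite uL /L /= !SE.
Qed.

Lemma identity_factor (x0 : oball X) : psi x0 != 0 ->
  exists (J : {linear Y -> WE1}) (A : {linear WE2 -> Y}),
    [/\ bounded_operator J, bounded_operator A & forall y, A (T (J y)) = y].
Proof.
move=> px0; have [e1 e1E] := const1 1.
have /choice[J JP] : forall y, exists f : WE1,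
    WE_val f = cst y /\ `|f| <= `|e1| * `|y|.
  move=> y; have [f fE fe] := WE_tensor sepW e1 y; exists f; split=> //.
  by rewrite fE e1E; apply/funext => x; rewrite /cst scale1r.
have lJ : linear J.
  move=> a y z; apply: val_inj.
  rewrite [LHS](JP _).1 linearP [X in _ = _ *: X + _](JP _).1 [X in _ = _ + X](JP _).1.
  by apply/funext.
pose J' : {linear Y -> WE1} := HB.pack J (GRing.isLinear.Build R[i] Y WE1 *:%R J lJ).
have [S SE] := WE_eval_linear x0.
pose A : {linear WE2 -> Y} := (psi x0)^-1 \*: S.
exists J', A; split.
- by exists `|e1| => y; exact: (JP y).2.
- have [M M0 xM] := WE_eval_bounded sepW normW compE2 x0.
  exists (`|(psi x0)^-1| * M) => f.
  by rewrite /A /= normrZ SE -mulrA ler_wpM2l.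
- move=> y; rewrite /A /= SE Top /wcomp (JP y).1 /cst.
  by rewrite scalerA mulVf // scale1r.
Qed.

(** In this section, compactness of the scalar operator enters through this estimate alone. *)
Hypothesis T_small : forall d : R[i], 0 < d ->
  exists (s : seq (oball X)) (m : nat), forall f,
    `|T f| <= d * `|f| + \sum_(x <- s) m%:R * `|WE_val (T f) x|.

Section pointwise_limits.
Variables (F : set_system WE1) (FU : UltraFilter F).
Hypothesis F1 : F (cunit_ball WE1).

(** The values at [x] stay in a fixed multiple of the unit ball of [Y], so after rescaling its norm
    or weak compactness gives a limit. *)
Lemma eval_in_multiple_ball (x : oball X) :
  exists m : nat, F [set f | cunit_ball Y (m.+1%:R^-1 *: WE_val f x)].
Proof.
have [M M0 xM] := WE_eval_bounded sepW normW compE1 x.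
have [m Mm] := archiC M0; exists m; apply: filterS F1 => f f1.
rewrite /cunit_ball /= normrZ normfV normr_nat ler_pdivrMl ?ltr0n // mulr1.
apply: le_trans (xM f) _; apply: (@le_trans _ _ m%:R); last by rewrite ler_nat.
by rewrite -[leRHS]mulr1 ler_pM.
Qed.

Lemma norm_limit : compact_operator (idfun : {linear Y -> Y}) ->
  exists2 g : WE1, `|g| <= 1 &
    forall x, (fun f => WE_val f x) @ F --> WE_val g x.
Proof.
rewrite /compact_operator image_id => -[K BK [cK _]].
have /choice[g gP] : forall x : oball X, exists y : Y, (fun f => WE_val f x) @ F --> y.
  move=> x; have [m Fm] := eval_in_multiple_ball x.
  have := cK; rewrite compact_ultra.
  move=> /(_ _ (fmap_ultra (fun f => m.+1%:R^-1 *: WE_val f x) FU)).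
  case=> [|p [_ Fp]]; first by apply: (filterS (F := F)) Fm => f; exact: BK.
  exists (m.+1%:R *: p).
  rewrite (_ : (fun f => _) = fun f : WE1 => m.+1%:R *: (m.+1%:R^-1 *: WE_val f x)).
    exact: cvgZl_tmp.
  by apply/funext => f; rewrite scalerA mulfV ?scale1r // pnatr_eq0.
have [//|w x Ww|g' g'E g'1] :=
  @WE_unit_ball_pointwise_closed _ _ _ _ sepW normW _ compE1 _ F _ id g.
  apply: cvg_comp (gP x) _; by have /asboolP[_] := valP w; apply.
by exists g' => [//|x]; rewrite g'E; exact: gP.
Qed.

Lemma weak_limit : weakly_compact_operator (idfun : {linear Y -> Y}) ->
  exists2 g : WE1, `|g| <= 1 &
    forall x (u : dual Y), (fun f => u (WE_val f x)) @ F --> (u (WE_val g x) : R[i]^o).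
Proof.
rewrite /weakly_compact_operator image_id => -[K BK [cK _]].
have /choice[g gP] : forall x : oball X, exists y : Y, forall u : dual Y,
    (fun f => u (WE_val f x)) @ F --> (u y : R[i]^o).
  move=> x; have [m Fm] := eval_in_multiple_ball x.
  have := cK; rewrite compact_ultra.
  move=> /(_ _ (fmap_ultra (fun f => m.+1%:R^-1 *: WE_val f x) FU)).
  case=> [|p [_ /weak_cvgP Fp]]; first by apply: (filterS (F := F)) Fm => f; exact: BK.
  exists (m.+1%:R *: p) => u.
  rewrite dualZ (_ : (fun f => _) =
    fun f : WE1 => m.+1%:R *: (u (m.+1%:R^-1 *: WE_val f x) : R[i]^o)).
    by apply: cvgZl_tmp; exact: Fp.
  apply/funext => f; have := dualZ u m.+1%:R (m.+1%:R^-1 *: WE_val f x).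
  by rewrite scalerA mulfV ?scale1r ?pnatr_eq0.
have [//|w x Ww|g' g'E g'1] :=
  @WE_unit_ball_pointwise_closed _ _ _ _ sepW normW _ compE1 _ F _ id g.
  exact: gP.
by exists g' => [//|x u]; rewrite g'E; exact: gP.
Qed.

End pointwise_limits.

Lemma compact_of_identity : compact_operator (idfun : {linear Y -> Y}) ->
  compact_operator T.
Proof.
move=> cI; exists (T @` cunit_ball WE1) => //.
suff cT : compact (T @` cunit_ball WE1).
  by split=> //; apply: compact_closed cT; exact: norm_hausdorff.
apply: image_compact => F FU F1.
have [g g1 Fg] := norm_limit FU F1 cI; exists g => //.
apply/cvgrPdist_le => /= d d0.
(* Since [|g - f| <= 2], the term [d / 4 * |g - f|] takes at most half of [d]; the finite sum takes
   the other half. *)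
have d40 : 0 < d / 4 by rewrite divr_gt0.
have [s [m Tsm]] := T_small d40.
have Fs : \forall f \near F, \sum_(x <- s) m%:R * `|WE_val (T (g - f)) x| <= d / 2.
  have : 0 < d / 2 by rewrite divr_gt0.
  move: (d / 2); elim: s {Tsm} => [|x s IH] r r0.
    by apply: nearW => f; rewrite big_nil ltW.
  have r20 : 0 < r / 2 by rewrite divr_gt0.
  (* The terms [m + 1] and [|psi x| + 1] replace [m] and [|psi x|] to avoid dividing by zero. *)
  have c0 : 0 < r / 2 / (m.+1%:R * (`|psi x| + 1)).
    by rewrite divr_gt0 // mulr_gt0 // addr_ge0.
  have /cvgrPdist_le/(_ _ c0) := Fg (phi x).
  apply: filterS2 (IH _ r20) => f h1 h2; rewrite big_cons [leRHS]splitr lerD //.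
  move: h2; rewrite ler_pdivlMr ?mulr_gt0 ?addr_ge0 //; apply: le_trans.
  rewrite linearB /= [X in `|X|](_ : _ = psi x *: (WE_val g (phi x) - WE_val f (phi x))).
    by rewrite normrZ mulrA [leRHS]mulrC ler_pM ?mulr_ge0 // ler_pM ?ler_nat // lerDl.
  by rewrite scalerBr -![_ *: _]/(wcomp psi phi _ x) -!Top.
move: Fs F1; apply: filterS2 => f fs f1; rewrite -linearB.
apply: le_trans (Tsm _) _; rewrite [leRHS]splitr lerD //.
have -> : d / 2 = d / 4 * 2.
  by rewrite -[RHS]mulrA (_ : 4^-1 * 2 = 2^-1) //; field.
rewrite ler_wpM2l ?(ltW d40) //; apply: le_trans (ler_normB _ _) _.
by rewrite -[leRHS]/(1 + 1) lerD.
Qed.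

Lemma weakly_compact_of_identity :
  weakly_compact_operator (idfun : {linear Y -> Y}) ->
  weakly_compact_operator T.
Proof.
move=> cI; exists (T @` cunit_ball WE1) => //.
suff cT : compact (T @` cunit_ball WE1 : set (weak WE2)).
  split=> //; apply: compact_closed cT; apply: weak_hausdorff.
  exact: WE_separating_dual.
apply: (@image_compact (weak WE2)) => F FU F1.
have [g g1 Fg] := weak_limit FU F1 cI; exists g => //.
apply/weak_cvgP => L.
(* It suffices to bound [Re (u (T (f - g)))] from above, for all multiples
   [u] of [L] by powers of ['i]. *)
have key (u : dual WE2) (d : R) : 0 < d ->
    \forall f \near F, complex.Re (u (T (f - g))) <= d.
  move=> d0; have [N N0 uN] := dual_bounded u.
  pose n := complex.Re N; have NE : N = n%:C by exact: ReK.
  have n0 : 0 <= n by rewrite -lecR -NE.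
  (* As [|f - g| <= 2], this makes [n * r * |f - g|] at most [d / 2]; [n + 1] instead of [n] avoids
     a zero denominator. *)
  pose r := d / 2 / ((n + 1) * 2).
  have r0 : 0 < r by rewrite !divr_gt0 ?mulr_gt0 // ltr_wpDl.
  have rC : 0 < r%:C :> R[i] by rewrite (ltcR 0).
  have [s [m Tsm]] := T_small rC.
  have /choice[S SE] : forall x, exists S : {linear WE1 -> Y},
      forall f, S f = WE_val (T f) x.
    move=> x; have [S SE] := WE_eval_linear x.
    by exists (S \o T) => f /=; rewrite SE.
  have lamP : real_linear (fun f => complex.Re (u (T f))).
    split=> [f f'|t f]; first by rewrite linearD dualD raddfD.
    rewrite linearZ /= dualZ.
    by case: (u _) => a b; simpc.
  have nr0 : 0 <= n * r by rewrite mulr_ge0 // ltW.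
  have nm0 : 0 <= n * m%:R by rewrite mulr_ge0.
  have lam_le f : complex.Re (u (T f)) <= n * r * complex.Re `|f| +
      \sum_(x <- s) n * m%:R * complex.Re `|S x f|.
    rewrite (le_trans (ler_norm _)) // -lecR (le_trans (Re_le_norm _)) //.
    apply: le_trans (uN _) _; apply: le_trans (ler_wpM2l N0 (Tsm f)) _.
    rewrite rmorphD mulrDr mulr_sumr rmorph_sum lerD //.
      by rewrite NE {1}(ReK (normr_ge0 f)) -!rmorphM mulrA.
    apply: ler_sum => x _; rewrite -SE NE -(rmorph_nat (real_complex R)).
    by rewrite {1}(ReK (normr_ge0 (S x f))) -!rmorphM mulrA.
  (* The filter is translated by [g], and the value is [psi x] times the difference of
     [v (f (phi x))] and [v (g (phi x))], which tends to 0 by weak pointwise convergence. *)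
  have S_null x (v : dual Y) :
      (fun f => v (S x f)) @ ((fun f => f - g) @ F) --> (0 : R[i]^o).
    suff : (fun f => v (S x (f - g))) @ F --> (0 : R[i]^o) by [].
    have -> : (fun f => v (S x (f - g))) =
        (fun f => psi x *: (v (WE_val f (phi x)) - v (WE_val g (phi x)) : R[i]^o)).
      by apply/funext => f; rewrite SE Top /wcomp dualZ -dualB.
    rewrite -[X in _ --> X](scaler0 _ (psi x)).
    rewrite -[X in psi x *: X](subrr (v (WE_val g (phi x)))).
    by apply: cvgZl_tmp; apply: cvgB; [exact: Fg|exact: cvg_cst].
  have d20 : 0 < d / 2 by rewrite divr_gt0.
  have := real_linear_le_weak_null nm0 (norm_sublinear nr0) lamP lam_le S_null d20.
  move=> /= h; near=> f.
  have hf : complex.Re (u (T (f - g))) <= n * r * complex.Re `|f - g| + d / 2.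
    by near: f; exact: h.
  have f1 : `|f| <= 1 by near: f.
  apply: le_trans hf _; rewrite [leRHS]splitr lerD2r.
  apply: (@le_trans _ _ (n * r * 2)).
    rewrite ler_wpM2l // -lecR -ReK //; apply: le_trans (ler_normB _ _) _.
    by rewrite rmorph_nat -[leRHS]/(1 + 1) lerD.
  apply: (@le_trans _ _ ((n + 1) * r * 2)).
    by rewrite ler_wpM2r // ler_wpM2r ?(ltW r0) // lerDl.
  rewrite (_ : _ * 2 = d / 2) // /r; field.
  by rewrite gt_eqF // ltr_wpDl.
suff : (fun f => L (T f)) @ F --> (L (T g) : R[i]^o) by [].
apply/cvgrPdist_le => e e0.
have eE := ReK (ltW e0); have re0 : 0 < complex.Re e / 2.
  by rewrite divr_gt0 // -ltcR -eE.
have LZ (c : R[i]) f : (c *: L) f = c * L f by [].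
have LD f : L (T g) - L (T f) = - L (T (f - g)).
  by rewrite linearB dualB opprB.
have keyL (c : R[i]) :
    \forall f \near F, complex.Re (c * L (T (f - g))) <= complex.Re e / 2.
  by move: (key (c *: L) _ re0); apply: filterS => f; rewrite LZ.
near=> f; rewrite LD normrN eE [complex.Re e]splitr; apply: norm_le_of_Re.
- by near: f; exact: key.
- by near: f; exact: (keyL (- 1)).
- by near: f; exact: (keyL 'i).
- by near: f; exact: (keyL (- 'i)).
Unshelve. all: by end_near.
Qed.

End compact_composition.

(** The assumptions that [Y] and [psi] are nonzero exclude degenerate cases: for [Y = 0] the
    vector-valued operator is always bounded, and for [psi = 0] it is compact whatever [Y] is. *)
Theorem theorem3p1 (R : realType) (X Y : completeNormedModType R[i])
    (W : submodClosed (dual Y)) (E1 E2 : holo_space X)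
    (const1 : contains_constants E1) (const2 : contains_constants E2)
    (comp1 : unit_ball_co_compact E1) (comp2 : unit_ball_co_compact E2)
    (psi : oball X -> R[i]^o) (psi_holo : holomorphic psi)
    (phi : oball X -> oball X)
    (phi_holo : holomorphic (fun x => \val (phi x) : X)) :
  (forall sepW : separating W,
     (exists y : Y, y != 0) ->
     bounded_between (wcomp psi phi) E1 E2 <->
     bounded_between (wcomp psi phi) (WE sepW E1) (WE sepW E2))
  /\
  (forall normW : almost_norming W,
     let sepW := almost_norming_separating normW in
     (exists x, psi x != 0) ->
     compact_between (wcomp psi phi) E1 E2 ->
     [/\ compact_between (wcomp psi phi) (WE sepW E1) (WE sepW E2) <->
           compact_operator (idfun : {linear Y -> Y}),
         compact_operator (idfun : {linear Y -> Y}) <->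
           finite_dimensional Y &
         weakly_compact_between (wcomp psi phi) (WE sepW E1) (WE sepW E2) <->
           weakly_compact_operator (idfun : {linear Y -> Y})]).
Proof.
have psi_cont : continuous psi by exact: holomorphic_continuous.
have phi_cont : continuous phi.
  exact: holomorphic_self_map_continuous.
split=> [sepW y0|normW sepW [x0 px0] [T Top cT]].
  by split; [exact: bounded_between_WE|exact: bounded_between_of_WE].
have [T' T'op _] : bounded_between (wcomp psi phi) (WE sepW E1) (WE sepW E2).
  apply: bounded_between_WE => //; exists T => //.
  exact: compact_operator_bounded.
have small (d : R[i]) : 0 < d -> exists (s : seq (oball X)) (m : nat), forall f,
    `|T' f| <= d * `|f| + \sum_(x <- s) m%:R * `|WE_val (T' f) x|.
  move=> d0; have [s [m Tsm]] := compact_operator_estimate comp2 cT d0.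
  exists s, m => f; apply: WE_norm_le => [|w e Ww w1 ew].
    rewrite addr_ge0 ?mulr_ge0 ?(ltW d0) //.
    by apply: sumr_ge0 => x _; rewrite mulr_ge0.
  have [e1 e1w e1f] := WE_comp f Ww.
  (* Both realize [w \o T' f], since composing with [w] turns the vector-valued operator into the
     scalar one. *)
  have eE : e = T e1.
    apply: (hs_inj E2); rewrite ew [RHS](Top e1) /= e1w -wcomp_dual.
    by congr (_ \o _); exact: (T'op f).
  have {}e1f : `|e1| <= `|f|.
    by apply: le_trans e1f _; rewrite -[leRHS]mul1r ler_wpM2r.
  rewrite eE (le_trans (Tsm e1)) // lerD //; first by rewrite ler_wpM2l // ltW.
  apply: ler_sum => x _; rewrite ler_wpM2l // -eE ew /=.
  apply: le_trans (dual_le _ _) _.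
  by rewrite -[leRHS]mul1r ler_wpM2r.
have factor (S : {linear WE sepW E1 -> WE sepW E2}) : induces (wcomp psi phi) S ->
    exists (J : {linear Y -> WE sepW E1}) (A : {linear WE sepW E2 -> Y}),
    [/\ bounded_operator J, bounded_operator A & forall y, A (S (J y)) = y].
  by move=> Sop; exact: (identity_factor const1 comp2 Sop px0).
split; [split|exact: compact_idfun_finite_dimensional|split].
- move=> [S Sop cS]; have [J [A [bJ bA ASJ]]] := factor S Sop.
  exact: compact_factor ASJ cS.
- by move=> cI; exists T' => //; exact: (compact_of_identity comp1 T'op small cI).
- move=> [S Sop cS]; have [J [A [bJ bA ASJ]]] := factor S Sop.
  by apply: (weakly_compact_factor bJ bA ASJ) => //; exact: (separating_dual normW).
- move=> cI; exists T' => //.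
  exact: (weakly_compact_of_identity comp1 comp2 T'op small cI).
Qed.
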